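(* There exist constants $\Delta > \delta > 0$ such that, for every integer $n \ge 2$, there exists a Littlewood polynomial $P(z)$ of degree $n$ with \[ \delta \sqrt{n} \le |P(z)| \le \Delta \sqrt{n} \] for all $z \in \mathbb{C}$ with $|z| = 1$.
   Context: A Littlewood polynomial of degree $n$ is a polynomial $P(z)=\sum_{k=0}^{n}\varepsilon_k z^k$ with $\varepsilon_k\in\{-1,1\}$ for all $0\le k\le n$. *)

(* Defs.v *)
From mathcomp Require Import all_boot all_order all_algebra.
From mathcomp Require Import complex.
From mathcomp Require Import reals.
Set Implicit Arguments. Unset Strict Implicit. Unset Printing Implicit Defensive.
Import Order.TTheory GRing.Theory Num.Theory.
Local Open Scope ring_scope.

Definition littlewood (C : nzRingType) (n : nat) (p : {poly C}) : Prop :=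
  size p = n.+1 /\ forall k : nat, (k <= n)%N -> p`_k = 1 \/ p`_k = -1.

(* Main.v *)
Require Import Defs.
From mathcomp Require Import all_boot all_order all_algebra.
From mathcomp Require Import complex.
From mathcomp Require Import reals.
From mathcomp Require Import boolp classical_sets topology normedtype derive sequences exp trigo.
(* [classical_sets] shadows [setT] and [subsetP] *)
From mathcomp Require Import fintype finset.
From mathcomp Require Import ring lra zify.
Set Implicit Arguments. Unset Strict Implicit. Unset Printing Implicit Defensive.
Import Order.TTheory GRing.Theory Num.Theory numFieldNormedType.Exports.
Import Normc.
Local Open Scope ring_scope.
Local Open Scope complex_scope.

(* After Balister, Bollobas, Morris, Sahasrabudhe and Tiba.  Write P(z) = z^m (e_0 + 2 c + 2 i s)
   with z = e^(i th), where the cosine polynomial c uses a few even frequencies and the sine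
   polynomial s uses all the others; it suffices that c and s are O(sqrt n) and never both small.
   Take c = Re(w^T P_t(w) + w^(2T) Q_t(w)) with w = e^(2 i th), P_t and Q_t a Rudin-Shapiro pair
   of length 2^t and 2^t << T << n: on windows of length ~1/T the pair is nearly constant, so c
   is essentially a trigonometric polynomial of degree 2 and is small only in boundedly many
   cells of length ~1/n per window.  Put a positive bump of width ~1/n (an odd-frequency Fejer
   kernel) with a sign at each bad cell, equal signs at nearby cells.  As there are only O(T) << n
   signs, a discrepancy theorem chooses them so that all sine coefficients of the sum of bumps are
   at most 1 in modulus, even after scaling it by a large multiple of sqrt n.  Finally the
   coefficients are rounded to +-1 with uniform error O(sqrt n), again by discrepancy. *)

(** * Discrepancy *)

(** The discrepancy bound has the form [(rows * columns)^(1/4)]. For [T + 1] signs against [2 M]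
    frequencies, [M = T b], it is of order [sqrt M / b^(1/4)], so a large constant [b] pays for
    bumps tall enough to survive the final rounding, whose error is a fixed multiple of [sqrt M].
    Hence the order of choice: [rho], then [b = 2^(4 rho + 2)], then [a] with [T = 2^a 2^t]; only
    [t] grows with the degree. In a sine polynomial every bump at an angle [u] comes with a mirror
    bump of opposite sign at [-u]. The two overlap when [u] is near 0, and near [pi / 2] the mirror
    kernel, read at [th + u] close to [pi], is again near modulus 1; so the ends of the quarter
    circle must contain no bad cells. This is why [t] is odd: at [w = 1] and at [w = -1] one of the
    pair then vanishes and the other has modulus [sqrt(2^(t+1))], whereas for even [t >= 2] the
    cosine polynomial would be zero at [w = -1]. Even frequencies in the cosine part and odd ones in
    the bumps make both moduli invariant under [th -> -th] and [th -> pi - th], so only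
    [0 <= th <= pi / 2] has to be treated. *)

Section Moments.
Context {R : realType} {J : finType}.
Implicit Types (X : {set J}) (e : {ffun J -> bool}) (a : J -> R).

Definition signed_sum a X e : R := \sum_(j in X) a j * (-1) ^+ e j.

Definition flip (j : J) e : {ffun J -> bool} := [ffun i => (i == j) (+) e i].

Lemma flipK j : involutive (flip j).
Proof. by move=> e; apply/ffunP => i; rewrite !ffunE addbA addbb addFb. Qed.

Lemma signed_sum_flip a X e j : j \notin X ->
  signed_sum a X (flip j e) = signed_sum a X e.
Proof.
move=> jX; apply: eq_bigr => i iX; rewrite ffunE.
by have [ij|//] := eqVneq i j; rewrite -ij iX in jX.
Qed.

(** Pairing each colouring with its flip at [j] averages over the sign of [a j]; the factor 2 counts
    both members of a pair. *)
Lemma sum_signed_sumU1 a X j (F : R -> R) : j \notin X ->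
  2 * \sum_e F (signed_sum a (j |: X) e) =
  \sum_e (F (signed_sum a X e + a j) + F (signed_sum a X e - a j)).
Proof.
move=> jX; have E e : signed_sum a (j |: X) e = signed_sum a X e + a j * (-1) ^+ e j.
  by rewrite /signed_sum big_setU1//= addrC.
rewrite mulr2n mulrDl mul1r {2}(reindex_inj (inv_inj (flipK j))) -big_split /=.
apply: eq_bigr => e _; rewrite !E signed_sum_flip// ffunE eqxx /=.
by case: (e j); rewrite /= ?mulr1 ?mulrN1 // addrC.
Qed.

(** Averaging over the sign of a new element kills the odd powers, so each moment obeys a recursion
    in the lower ones; hence the joint induction. The factors 1, 3, 15 are the even moments of a
    standard Gaussian. *)
Lemma signed_sum_moments a X : (forall j, `|a j| <= 1) ->
  let n := #|X|%:R : R in let N := #|{ffun J -> bool}|%:R : R in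
  [/\ \sum_e signed_sum a X e ^+ 2 <= n * N,
      \sum_e signed_sum a X e ^+ 4 <= 3 * n ^+ 2 * N &
      \sum_e signed_sum a X e ^+ 6 <= 15 * n ^+ 3 * N].
Proof.
move=> a1 /=; set N : R := #|{ffun J -> bool}|%:R.
have N0 : 0 <= N by [].
have half2 (x y : R) : 2 * x = 2 * y -> x = y by lra.
have sumc (x : R) : \sum_(e : {ffun J -> bool}) x = x * N.
  by rewrite sumr_const mulr_natr.
have [k] := ubnP #|X|; elim: k X => // k IH X.
have [->|[j jX]] := set_0Vmem X.
  move=> _; rewrite cards0 /signed_sum.
  split; rewrite big1 ?expr0n ?mulr0 ?mul0r // => e _; by rewrite big_set0 expr0n.
rewrite -(setD1K jX); set Y := X :\ j; have jY : j \notin Y by rewrite !inE eqxx.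
rewrite cardsU1 jY add1n ltnS => /IH [m2 m4 m6].
have n0 : 0 <= (#|Y|%:R : R) by [].
rewrite -natr1; set n : R := #|Y|%:R in m2 m4 m6 n0 *.
have aa : a j ^+ 2 <= 1 by rewrite -real_normK ?num_real // expr_le1.
have aa0 := sqr_ge0 (a j).
set A := a j ^+ 2 in aa aa0.
have E2 := sum_signed_sumU1 a (fun x => x ^+ 2) jY.
have E4 := sum_signed_sumU1 a (fun x => x ^+ 4) jY.
have E6 := sum_signed_sumU1 a (fun x => x ^+ 6) jY.
set s2 := \sum_e signed_sum a Y e ^+ 2 in m2.
set s4 := \sum_e signed_sum a Y e ^+ 4 in m4.
set s6 := \sum_e signed_sum a Y e ^+ 6 in m6.
have H2 : \sum_e signed_sum a (j |: Y) e ^+ 2 = s2 + A * N.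
  apply: half2; rewrite E2 /s2 -sumc -big_split mulr_sumr.
  by apply: eq_bigr => e _; rewrite /A /=; ring.
have H4 : \sum_e signed_sum a (j |: Y) e ^+ 4 = s4 + 6 * A * s2 + A ^+ 2 * N.
  apply: half2; rewrite E4 /s2 /s4 -sumc [6 * A * _]mulr_sumr -!big_split mulr_sumr.
  by apply: eq_bigr => e _; rewrite /A /=; ring.
have H6 : \sum_e signed_sum a (j |: Y) e ^+ 6 =
    s6 + 15 * A * s4 + 15 * A ^+ 2 * s2 + A ^+ 3 * N.
  apply: half2.
  rewrite E6 /s2 /s4 /s6 -sumc [15 * A * _]mulr_sumr [15 * A ^+ 2 * _]mulr_sumr -!big_split mulr_sumr.
  by apply: eq_bigr => e _; rewrite /A /=; ring.
have p2 : 0 <= s2 by apply: sumr_ge0 => e _; apply: sqr_ge0.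
have p4 : 0 <= s4 by apply: sumr_ge0 => e _; apply: exprn_even_ge0.
have A2 : A ^+ 2 <= 1 by rewrite expr_le1.
have A3 : A ^+ 3 <= 1 by rewrite expr_le1.
have le1 (x y : R) : 0 <= x -> y <= 1 -> y * x <= x.
  by move=> x0 y1; rewrite ler_piMl.
have q2 := le1 _ _ p2 aa; have q4 := le1 _ _ p4 aa; have q22 := le1 _ _ p2 A2.
have N1 := le1 _ _ N0 aa; have N2 := le1 _ _ N0 A2; have N3 := le1 _ _ N0 A3.
have nN : 0 <= n * N by rewrite mulr_ge0.
rewrite H2 H4 H6; split; lra.
Qed.

End Moments.

(** [Num.truncn] is 0 on negatives, so the truncations of [x] and [- x] together amount to rounding
    towards zero. The class of zero reaches from -1 to 1, which is why the bound is 2. *)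
Lemma truncn_close (R : realType) (x y : R) :
  Num.truncn x = Num.truncn y -> Num.truncn (- x) = Num.truncn (- y) ->
  `|x - y| <= 2.
Proof.
have le0 (z : R) : z <= 0 -> Num.truncn z = 0%N.
  by move=> z0; apply/eqP; rewrite -leqn0 truncn_le_nat; lra.
wlog xy : x y / y <= x => [wl|] Exy Nxy.
  have [yx|xy] := leP y x; first exact: wl.
  by rewrite distrC; apply: wl => //; exact: ltW.
rewrite ger0_norm ?subr_ge0//.
have [x0|x0] := leP 0 x; have [y0|y0] := leP 0 y.
- have := truncnS_gt x; rewrite Exy -natr1.
  have : (Num.truncn y)%:R <= y by rewrite truncn_le.
  lra.
- have := truncnS_gt x; rewrite Exy (le0 y) ?(ltW y0)//.
  have := truncnS_gt (- y); rewrite -Nxy (le0 (- x)); lra.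
- by have := lt_le_trans x0 (le_trans y0 xy); rewrite ltxx.
- have := truncnS_gt (- y); rewrite -Nxy -natr1.
  have : (Num.truncn (- x))%:R <= - x by rewrite truncn_le; lra.
  lra.
Qed.

(** Give [e] the weight [y] to the power of its Hamming distance from [e0]. All weights sum to
    [(1 + y) ^+ #|J|], and each element of [S] weighs at least [y ^+ r]. *)
Lemma hamming_ball_card (R : realType) (J : finType) (y : R)
    (S : {set {ffun J -> bool}}) (r : nat) (e0 : {ffun J -> bool}) :
  0 < y <= 1 -> (forall e, e \in S -> (#|[set j | e j != e0 j]| <= r)%N) ->
  #|S|%:R * y ^+ r <= (1 + y) ^+ #|J|.
Proof.
move=> /andP[y0 y1] near.
pose F (e : {ffun J -> bool}) := \prod_j (if e j != e0 j then y else 1).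
have FE e : F e = y ^+ #|[set j | e j != e0 j]|.
  rewrite /F -big_mkcond /= prodr_const; congr (_ ^+ _).
  by apply: eq_card => j; rewrite !inE.
have -> : (1 + y) ^+ #|J| = \sum_e F e.
  rewrite -(bigA_distr_bigA (fun j (b : bool) => if b != e0 j then y else 1)).
  rewrite -prodr_const; apply: eq_bigr => j _.
  by rewrite big_bool; case: (e0 j) => //=; rewrite addrC.
rewrite mulr_natl -sumr_const.
apply: (@le_trans _ _ (\sum_(e in S) F e)).
  apply: ler_sum => e eS; rewrite FE.
  by rewrite ler_wiXn2l ?near// ltW.
rewrite [leRHS](bigID (mem S)) /= lerDl sumr_ge0// => e _.
by rewrite FE exprn_ge0 // ltW.
Qed.

Lemma geometric_le (R : realType) (x : R) (n : nat) :
  0 <= x <= 1/2 -> \sum_(k < n) x ^+ k <= 1 + 2 * x.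
Proof.
move=> x01; suff : (1 - x) * \sum_(k < n) x ^+ k <= 1.
  set s := \sum_(k < n) _ => h.
  have x0 : 0 < 1 - x by lra.
  rewrite -(ler_pM2l x0) (le_trans h)//; nra.
rewrite -opprB mulNr -subrX1 opprB lerBlDr lerDl exprn_ge0; lra.
Qed.

(* Jensen's inequality, from [1 + x <= exp x]. *)
Lemma expR_mean (R : realType) (T : finType) (f : T -> R) (s k : R) : 0 <= s ->
  \sum_e f e <= k * #|T|%:R -> #|T|%:R * expR (- (s * k)) <= \sum_e expR (- (s * f e)).
Proof.
move=> s0 sum_f.
have : \sum_(e : T) (1 - s * f e + s * k) * expR (- (s * k)) <= \sum_e expR (- (s * f e)).
  apply: ler_sum => e _.
  have -> : - (s * f e) = (s * k - s * f e) - s * k by lra.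
  rewrite expRD ler_wpM2r ?expR_ge0//.
  by apply: le_trans (expR_ge1Dx _); lra.
apply: le_trans; rewrite -mulr_suml ler_wpM2r ?expR_ge0//.
rewrite !big_split /= sumrN -mulr_sumr !sumr_const -[(s * k) *+ _]mulr_natr.
have : s * \sum_e f e <= s * (k * #|T|%:R) by rewrite ler_wpM2l.
lra.
Qed.

(** * Partial colouring by counting *)

Section PartialColoring.
Context {R : realType} {I J : finType}.

(* Counting: [b e] records the rounded row sums of [e] (of both signs).  If no two colourings
   with the same record were far apart, each class would lie in a Hamming ball; weighting
   a record by [exp (- s * sum)] then makes the number of colourings smaller than [2 ^ #|J|]. *)
Lemma partial_coloring (a : I -> J -> R) (D : R) :
  (forall i j, `|a i j| <= 1) -> (0 < #|J|)%N -> (#|J| <= #|I|)%N -> 0 < D ->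
  512 * #|I|%:R * #|J|%:R <= D ^+ 4 ->
  exists e e' : {ffun J -> bool}, (#|J| <= 20 * #|[set j | e j != e' j]|)%N /\
    forall i, `|signed_sum (a i) setT e - signed_sum (a i) setT e'| <= 2 * D.
Proof.
move=> a1 J0 JI D0 hD.
pose L i e : R := signed_sum (a i) setT e.
pose x (u : I * bool) e : R := (-1) ^+ u.2 * L u.1 e / D.
pose B := Num.truncn (#|J|%:R / D).
have Lle i e : `|L i e| <= #|J|%:R.
  apply: le_trans (ler_norm_sum _ _ _) _.
  rewrite -cardsT -sumr_const; apply: ler_sum => j _.
  by rewrite normrM normrX normrN1 expr1n mulr1.
have xB u e : (Num.truncn (x u e) < B.+1)%N.
  rewrite ltnS; apply: le_truncn; rewrite /x ler_pM2r ?invr_gt0//.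
  apply: le_trans (ler_norm _) _; by rewrite normrM normrX normrN1 expr1n mul1r.
pose b e : {ffun I * bool -> 'I_B.+1} := [ffun u => Ordinal (xB u e)].
apply: contrapT => Hno.
pose r := (#|J| %/ 20)%N.
have near e e' : b e = b e' -> (#|[set j | e j != e' j]| <= r)%N.
  move=> bee; rewrite leqNgt; apply/negP => far; apply: Hno; exists e, e'; split.
    rewrite /r in far; move: far; set k := #|_|; set n := #|_|; lia.
  move=> i.
  have H c : Num.truncn (x (i, c) e) = Num.truncn (x (i, c) e').
    by have /ffunP/(_ (i, c)) := bee; rewrite !ffunE => /(congr1 val).
  have xf f : x (i, false) f = L i f / D by rewrite /x expr0 mul1r.
  have xt f : x (i, true) f = - (L i f / D) by rewrite /x expr1 mulN1r mulNr.
  have := @truncn_close R (L i e / D) (L i e' / D).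
  move: (H false) (H true); rewrite !xf !xt => Hf Ht /(_ Hf Ht).
  by rewrite -mulrBl normrM normfV (gtr0_norm D0) ler_pdivrMr.
pose n : R := #|J|%:R; pose m : R := #|I|%:R.
have n0 : 0 < n by rewrite ltr0n.
have nm : n <= m by rewrite ler_nat.
have m0 : 0 < m by apply: lt_le_trans nm.
pose cost e : R := \sum_u (b e u)%:R.
(* A truncation is at most the sixth power of its argument, since it vanishes below 1; so the
   sixth-moment bound [15 * n ^+ 3], over [2 * m] signed rows, bounds the mean cost by [k]. *)
pose k := 30 * m * n ^+ 3 / D ^+ 6.
pose N := #|{ffun J -> bool}|%:R : R.
have costE : \sum_e cost e <= k * N.
  have le6 u e : (b e u)%:R <= x u e ^+ 6.
    rewrite ffunE /=; have [x1|x1] := leP 1 (x u e).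
      apply: (@le_trans _ _ (x u e)); first by rewrite truncn_le; lra.
      by rewrite -{1}[x u e]expr1 ler_weXn2l.
    have -> : Num.truncn (x u e) = 0%N by apply/eqP; rewrite -leqn0 truncn_le_nat.
    by rewrite exprn_even_ge0.
  apply: (@le_trans _ _ (\sum_e \sum_u x u e ^+ 6)).
    by apply: ler_sum => e _; apply: ler_sum => u _; exact: le6.
  rewrite exchange_big /=.
  apply: (@le_trans _ _ (\sum_(u : I * bool) 15 * n ^+ 3 / D ^+ 6 * N)).
    apply: ler_sum => u _.
    have [_ _ M6] := signed_sum_moments setT (a1 u.1).
    have -> : \sum_e x u e ^+ 6 = (\sum_e L u.1 e ^+ 6) / D ^+ 6.
      rewrite mulr_suml; apply: eq_bigr => e _.
      have s6 : ((-1) ^+ u.2) ^+ 6 = 1 :> R by rewrite -exprM -signr_odd oddM andbF.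
      by rewrite /x 2!exprMn exprVn s6 mul1r.
    have D6 : 0 <= D ^- 6 by rewrite invr_ge0 exprn_ge0 ?ltW.
    rewrite mulrAC ler_wpM2r//.
    by rewrite cardsT in M6.
  rewrite sumr_const card_prod card_bool -[leLHS]mulr_natr natrM /k -/m.
  by rewrite le_eqVlt; apply/orP; left; apply/eqP; field; rewrite gt_eqF.
(* The rate [s] must satisfy [expR s >= 80 * m / n]. Squaring [1 + w <= expR w] gives this without
   logarithms, and [s] of order [sqrt (m / n)] still keeps [s * k <= n / 10] thanks to
   [D ^+ 4 >= 512 * m * n]. *)
pose w := Num.sqrt (80 * m / n).
have w2 : w ^+ 2 = 80 * m / n.
  by rewrite sqr_sqrtr// divr_ge0// ?mulr_ge0 ?(ltW n0) ?(ltW m0).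
have w0 : 0 <= w by rewrite sqrtr_ge0.
pose s := 2 * w.
have s0 : 0 <= s by rewrite mulr_ge0.
have es : 80 * m / n <= expR s.
  have -> : s = w + w by rewrite /s; lra.
  have := expR_ge1Dx w; rewrite expRD => ?.
  by rewrite -w2 expr2; nra.
have mn1 : 1 <= m / n by rewrite ler_pdivlMr// mul1r.
pose q := expR (- s).
have q0 : 0 < q by exact: expR_gt0.
have qle : 80 * m * q <= n.
  by rewrite /q expRN ler_pdivrMr ?expR_gt0// [n * _]mulrC -ler_pdivrMr.
have q1 : q <= 1 / 80 by nra.
have sk : s * k <= n / 10.
  have kE : k * D ^+ 6 = 30 * m * n ^+ 3 by rewrite /k divfK// expf_neq0// gt_eqF.
  have k0 : 0 <= k.
    rewrite /k divr_ge0 ?exprn_ge0 ?(ltW D0)//.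
    by rewrite !mulr_ge0 ?exprn_ge0 ?(ltW n0) ?(ltW m0).
  have n10 : 0 <= n / 10 by rewrite divr_ge0 ?ltW.
  rewrite -(@ler_pXn2r _ 2) ?nnegrE ?(mulr_ge0 s0)//.
  have D12 : 0 < D ^+ 12 by rewrite exprn_gt0.
  rewrite -(ler_pM2r D12).
  have -> : (s * k) ^+ 2 * D ^+ 12 = 4 * w ^+ 2 * (k * D ^+ 6) ^+ 2.
    by rewrite /s; ring.
  rewrite kE w2.
  have h12 : (512 * m * n) ^+ 3 <= D ^+ 12.
    rewrite (_ : D ^+ 12 = (D ^+ 4) ^+ 3); last by rewrite -exprM.
    by rewrite ler_pXn2r ?nnegrE ?mulr_ge0 ?exprn_ge0 ?(ltW n0) ?(ltW m0) ?(ltW D0).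
  apply: (@le_trans _ _ ((n / 10) ^+ 2 * (512 * m * n) ^+ 3)); last first.
    by rewrite ler_wpM2l ?sqr_ge0.
  have -> : 4 * (80 * m / n) * (30 * m * n ^+ 3) ^+ 2 = (4 * 80 * 30 ^+ 2) * (m ^+ 3 * n ^+ 5).
    by field; rewrite gt_eqF.
  have -> : (n / 10) ^+ 2 * (512 * m * n) ^+ 3 = (512 ^+ 3 / 100) * (m ^+ 3 * n ^+ 5).
    by field.
  rewrite ler_wpM2r ?mulr_ge0 ?exprn_ge0 ?(ltW n0) ?(ltW m0)//.
  lra.
have E1 := expR_mean s0 costE.
(* Group by record: a class lies in a Hamming ball of radius [n / 20], so with [y = 1/8] it has at
   most [(9/8)^n 8^(n/20)] elements, which is at most [expR (n/8 + 3n/20)]. The sum over records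
   factors into geometric series. *)
have E2 : \sum_e expR (- (s * cost e)) <= expR (11 / 40 * n) * expR (4 * m * q).
  rewrite (partition_big b xpredT)//=.
  have qc e : expR (- (s * cost e)) = \prod_u q ^+ b e u.
    rewrite /cost mulr_sumr -sumrN expR_sum; apply: eq_bigr => u _.
    by rewrite -mulNr expRM_natr.
  apply: (@le_trans _ _ (\sum_(c : {ffun I * bool -> 'I_B.+1})
      expR (11 / 40 * n) * \prod_u q ^+ c u)).
    apply: ler_sum => c _.
    have -> : \sum_(e | b e == c) expR (- (s * cost e)) =
        \sum_(e | b e == c) \prod_u q ^+ c u.
      by apply: eq_bigr => e /eqP <-; rewrite qc.
    rewrite sumr_const -[leLHS]mulr_natl ler_wpM2r//.
      by apply: prodr_ge0 => u _; rewrite exprn_ge0// ltW.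
    pose S := [set e | b e == c].
    have -> : #|[pred e | b e == c]| = #|S| by apply: eq_card => e; rewrite !inE.
    have [->|[e0 e0S]] := set_0Vmem S; first by rewrite cards0 expR_ge0.
    have y01 : 0 < (1/8 : R) <= 1 by lra.
    have nearS e : e \in S -> (#|[set j | e j != e0 j]| <= r)%N.
      by move=> eS; apply: near; move: eS e0S; rewrite !inE => /eqP -> /eqP ->.
    have := hamming_ball_card y01 nearS.
    have -> : (1 / 8 : R) ^+ r = (8 ^+ r)^-1 by rewrite -exprVn; congr (_ ^+ _); lra.
    rewrite ler_pdivrMr ?exprn_gt0// => /le_trans; apply.
    have e2 : 2 <= expR 1 :> R by have := expR_ge1Dx (1 : R); lra.
    have e8 : 8 <= expR 3 :> R.
      have -> : 3 = 3%:R * 1 :> R by lra.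
      rewrite expRM_natl (_ : 8 = 2 ^+ 3 :> R); last by lra.
      by rewrite ler_pXn2r ?nnegrE ?expR_ge0.
    have -> : 11 / 40 * n = (1 / 8) * n + 3 * (n / 20) by lra.
    rewrite expRD ler_pM ?exprn_ge0//; first lra.
      by rewrite expRM_natr; apply: lerXn2r; rewrite ?nnegrE ?expR_ge0 ?expR_ge1Dx//; lra.
    apply: (@le_trans _ _ (expR (3 * r%:R))).
      by rewrite expRM_natr; apply: lerXn2r; rewrite ?nnegrE ?expR_ge0.
    rewrite ler_expR ler_wpM2l// ler_pdivlMr// -natrM ler_nat.
    exact: leq_trunc_div.
  rewrite -mulr_sumr ler_wpM2l ?expR_ge0//.
  rewrite -(bigA_distr_bigA (fun (u : I * bool) (j : 'I_B.+1) => q ^+ j)).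
  apply: (@le_trans _ _ (\prod_(u : I * bool) (1 + 2 * q))).
    apply: ler_prod => u _; apply/andP; split.
      by apply: sumr_ge0 => j _; rewrite exprn_ge0// ltW.
    by apply: geometric_le; lra.
  rewrite prodr_const card_prod card_bool.
  have -> : 4 * m * q = (2 * q) * (#|I| * 2)%:R by rewrite natrM /m; lra.
  by rewrite expRM_natr; apply: lerXn2r; rewrite ?nnegrE ?expR_ge0 ?expR_ge1Dx//; lra.
have E3 : expR (n / 2) <= #|{ffun J -> bool}|%:R.
  rewrite card_ffun card_bool natrX.
  have -> : n / 2 = (1 / 2) * #|J|%:R by rewrite /n; lra.
  rewrite expRM_natr; apply: lerXn2r; rewrite ?nnegrE ?expR_ge0//.
  have := expR_ge1Dx (- (1 / 2) : R); rewrite expRN => h.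
  have h0 := expR_gt0 (1 / 2 : R).
  have := ler_wpM2r (ltW h0) h; rewrite mulVf ?gt_eqF//; lra.
(* This is contradictory: [n/2 - n/10] exceeds [11n/40 + n/20], where the last term bounds
   [4 * m * q]. *)
have : expR (n / 2) * expR (- (s * k)) <= expR (11 / 40 * n) * expR (4 * m * q).
  by apply: le_trans E2; apply: le_trans E1; rewrite ler_wpM2r ?expR_ge0.
rewrite -!expRD ler_expR => h; lra.
Qed.

End PartialColoring.

(** * From partial to full colourings, and rounding of real vectors *)

Section Discrepancy.
Context {R : realType} {I J : finType}.
Implicit Types (a : I -> J -> R) (X : {set J}) (e : {ffun J -> bool}).

Lemma partial_coloring_set a X (D : R) :
  (forall i j, `|a i j| <= 1) -> (0 < #|X|)%N -> (#|X| <= #|I|)%N -> 0 < D ->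
  512 * #|I|%:R * #|X|%:R <= D ^+ 4 ->
  exists e e', (#|X| <= 20 * #|[set j in X | e j != e' j]|)%N /\
    forall i, `|signed_sum (a i) X e - signed_sum (a i) X e'| <= 2 * D.
Proof.
move=> a1 X0 XI D0 hD; have /card_gt0P[x0 x0X] := X0.
have := @partial_coloring R I 'I_#|X| (fun i j => a i (enum_val j)) D.
rewrite card_ord => /(_ (fun i j => a1 i _) X0 XI D0 hD) [e [e' [ee' eP]]].
pose ext (f : {ffun 'I_#|X| -> bool}) : {ffun J -> bool} :=
  [ffun j => f (enum_rank_in x0X j)].
have extE f i : signed_sum (a i) X (ext f) =
    signed_sum (fun j => a i (enum_val j)) setT f.
  rewrite /signed_sum big_enum_val; apply: eq_big => j; first by rewrite inE.
  by move=> _; rewrite ffunE enum_valK_in.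
exists (ext e), (ext e'); split; last by move=> i; rewrite !extE.
apply: leq_trans ee' _; rewrite leq_mul2l/=.
rewrite -(card_imset _ enum_val_inj); apply/subset_leq_card/subsetP => _ /imsetP[j + ->].
by rewrite !inE !ffunE enum_valK_in enum_valP.
Qed.

(** Half the difference of two colourings is a partial colouring: 0 where they agree, a sign where
    they differ. Each round costs [5 * D], allowed as [512 <= 5 ^ 4], and leaves at most 19/20 of
    [X]; as [(99/100) ^ 4 >= 19/20], the next round may use [99/100 * D], and the geometric series
    sums to [500 * D]. *)
Lemma discrepancy a X (D : R) :
  (forall i j, `|a i j| <= 1) -> (#|X| <= #|I|)%N -> 0 < D ->
  #|I|%:R * #|X|%:R <= D ^+ 4 ->
  exists e, forall i, `|signed_sum (a i) X e| <= 500 * D.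
Proof.
move=> a1; have [n] := ubnP #|X|; elim: n X D => // n IH X D Xn XI D0 hD.
have [->|[x0 x0X]] := set_0Vmem X.
  exists [ffun=> false] => i; rewrite /signed_sum big_set0 normr0; lra.
have X0 : (0 < #|X|)%N by apply/card_gt0P; exists x0.
have [||e [e' [ee' eP]]] := @partial_coloring_set a X (5 * D) a1 X0 XI; first lra.
  have -> : 512 * #|I|%:R * #|X|%:R = 512 * (#|I|%:R * #|X|%:R) :> R by ring.
  have -> : (5 * D) ^+ 4 = 625 * D ^+ 4 by ring.
  have : 0 <= #|I|%:R * #|X|%:R :> R by rewrite mulr_ge0.
  lra.
pose Y := [set j in X | e j == e' j]; pose Z := [set j in X | e j != e' j].
have XYZ : #|X| = (#|Y| + #|Z|)%N.
  rewrite -(cardsID [set j | e j == e' j] X); congr (_ + _)%N.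
    by apply: eq_card => j; rewrite !inE.
  by apply: eq_card => j; rewrite !inE andbC.
have YX : 20 * #|Y|%:R <= 19 * #|X|%:R :> R.
  by rewrite -!natrM ler_nat; move: ee'; rewrite -/Z XYZ; lia.
have [||||f fP] := IH Y (99 / 100 * D).
- by move: ee' Xn; rewrite -/Z XYZ; move: X0; rewrite XYZ; lia.
- by apply: leq_trans XI; rewrite XYZ leq_addr.
- lra.
- have -> : (99 / 100 * D) ^+ 4 = (99 / 100) ^+ 4 * D ^+ 4 by ring.
  have : #|I|%:R * (20 * #|Y|%:R) <= #|I|%:R * (19 * #|X|%:R) :> R by rewrite ler_wpM2l.
  have : 0 <= D ^+ 4 by rewrite exprn_ge0 ?ltW.
  lra.
exists [ffun j => if j \in Y then f j else e j] => i.
have splitX (g : J -> R) : \sum_(j in X) g j = \sum_(j in Y) g j + \sum_(j in Z) g j.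
  rewrite (bigID (fun j => e j == e' j)) /=; congr (_ + _); apply: eq_bigl => j; by rewrite !inE.
have -> : signed_sum (a i) X [ffun j => if j \in Y then f j else e j] =
    signed_sum (a i) Y f + (signed_sum (a i) X e - signed_sum (a i) X e') / 2.
  rewrite /signed_sum !splitX.
  have -> : \sum_(j in Y) a i j * (-1) ^+ e' j = \sum_(j in Y) a i j * (-1) ^+ e j.
    by apply: eq_bigr => j; rewrite !inE => /andP[_ /eqP ->].
  have -> : \sum_(j in Z) a i j * (-1) ^+ e' j = - \sum_(j in Z) a i j * (-1) ^+ e j.
    rewrite -sumrN; apply: eq_bigr => j; rewrite !inE => /andP[_].
    by case: (e j); case: (e' j) => //=; rewrite !(mulrN1, mulr1) ?opprK.
  have -> : \sum_(j in Y) a i j * (-1) ^+ [ffun j => if j \in Y then f j else e j] j =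
      \sum_(j in Y) a i j * (-1) ^+ f j.
    by apply: eq_bigr => j jY; rewrite ffunE jY.
  have -> : \sum_(j in Z) a i j * (-1) ^+ [ffun j => if j \in Y then f j else e j] j =
      \sum_(j in Z) a i j * (-1) ^+ e j.
    by apply: eq_bigr => j; rewrite ffunE !inE => /andP[-> /negbTE ->].
  lra.
apply: le_trans (ler_normD _ _) _.
have := fP i; have := eP i; rewrite normrM [`|2^-1|]ger0_norm//; lra.
Qed.

(* Dyadic rounding: colour the set where the last binary digit is odd. *)
Lemma dyadic_rounding a (D : R) (t : nat) (u : J -> nat) :
  (forall i j, `|a i j| <= 1) -> (#|J| <= #|I|)%N -> 0 < D ->
  #|I|%:R * #|J|%:R <= D ^+ 4 -> (forall j, u j <= 2 ^ t)%N ->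
  exists z : J -> bool, forall i,
    `|\sum_j a i j * ((z j)%:R - (u j)%:R / 2 ^+ t)| <= 500 * (1 - (2 ^+ t)^-1) * D.
Proof.
move=> a1 JI D0 hD; elim: t u => [|t IH] u ut.
  exists (fun j => u j == 1%N) => i; rewrite big1 ?normr0 => [|j _]; last first.
    by have := ut j; case: (u j) => [|[|]]//= _; rewrite divr1 subrr mulr0.
  rewrite expr0 invr1; lra.
have [||e eP] := @discrepancy a [set j | odd (u j)] D a1 _ D0.
- exact: leq_trans (max_card _) JI.
- apply: le_trans hD; rewrite ler_wpM2l// ler_nat; exact: max_card.
(* An odd numerator moves to the even neighbour that the colouring selects and is then halved; the
   move changes row [i] by a signed sum divided by [2 ^+ t.+1]. *)
pose v j := (if odd (u j) then (if e j then (u j).-1 else (u j).+1) else u j)./2.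
have vE j : (v j).*2%:R = (u j)%:R + (if odd (u j) then (-1) ^+ e j else 0) :> R.
  rewrite /v; case: ifP => ou; last by rewrite addr0 even_halfK ?ou.
  have u0 : (0 < u j)%N by case: (u j) ou.
  case: (e j).
    by rewrite even_halfK -subn1 ?oddB ?ou// natrB.
  by rewrite even_halfK ?oddS ?ou// -natr1.
have [j|z zP] := IH v.
  have := ut j; rewrite expnS mul2n => uj.
  rewrite /v -[(2 ^ t)%N]doubleK; apply: half_leq; case: ifP => // ou.
  case: (e j); first exact: leq_trans (leq_pred _) uj.
  rewrite ltn_neqAle uj andbT; apply: contraTneq ou => ->.
  by rewrite odd_double.
exists z => i; have p2 : 0 < 2 ^+ t :> R by rewrite exprn_gt0.
have -> : \sum_j a i j * ((z j)%:R - (u j)%:R / 2 ^+ t.+1) =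
    \sum_j a i j * ((z j)%:R - (v j)%:R / 2 ^+ t) +
    (2 ^+ t.+1)^-1 * signed_sum (a i) [set j | odd (u j)] e.
  rewrite /signed_sum [X in _ * X]big_mkcond /= mulr_sumr -big_split; apply: eq_bigr => j _ /=.
  have := vE j; rewrite -mul2n natrM inE => vj.
  have -> : (u j)%:R = 2 * (v j)%:R - (if odd (u j) then (-1) ^+ e j else 0) :> R by lra.
  by rewrite exprS; case: ifP => _; field; rewrite gt_eqF.
apply: le_trans (ler_normD _ _) _; rewrite normrM.
rewrite [X in _ + X * _]ger0_norm ?invr_ge0 ?exprn_ge0//.
have := ler_wpM2l (_ : 0 <= (2 ^+ t.+1)^-1) (eP i).
rewrite invr_ge0 exprn_ge0// => /(_ isT).
have := zP i; rewrite exprS invfM; lra.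
Qed.

(** Truncate [(1 - x j) / 2] to [t] binary digits, with [t] so large that this costs at most [D] in
    every row. A sign is [1 - 2 * z] with [z] equal to 0 or 1, so the rounding error counts twice:
    [1001 = 2 * 500 + 1]. *)
Lemma linear_discrepancy a (D : R) (x : J -> R) :
  (forall i j, `|a i j| <= 1) -> (#|J| <= #|I|)%N -> 0 < D ->
  #|I|%:R * #|J|%:R <= D ^+ 4 -> (forall j, `|x j| <= 1) ->
  exists e : J -> bool, forall i,
    `|\sum_j a i j * ((-1) ^+ e j - x j)| <= 1001 * D.
Proof.
move=> a1 JI D0 hD x1.
pose t := (Num.truncn (2 * #|J|%:R / D)).+1.
have tP : 2 * #|J|%:R <= 2 ^+ t * D.
  have : 2 * #|J|%:R / D <= t%:R by apply/ltW/truncnS_gt.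
  rewrite ler_pdivrMr// => /le_trans; apply; rewrite ler_wpM2r ?(ltW D0)//.
  by rewrite -natrX ler_nat ltnW// ltn_expl.
have p2 : 0 < 2 ^+ t :> R by rewrite exprn_gt0.
pose u j := Num.truncn (2 ^+ t * (1 - x j) / 2).
have y01 j : 0 <= 2 ^+ t * (1 - x j) / 2 <= 2 ^+ t.
  have := x1 j; rewrite ler_norml => /andP[? ?]; apply/andP; split.
    by rewrite divr_ge0// mulr_ge0 ?(ltW p2)//; lra.
  nra.
have [j|z zP] := @dyadic_rounding a D t u a1 JI D0 hD.
  rewrite -(@ler_nat R) natrX; have /andP[y0 y1] := y01 j.
  by apply: le_trans y1; rewrite /u truncn_le.
exists z => i.
have -> : \sum_j a i j * ((-1) ^+ z j - x j) =
    -2 * \sum_j a i j * ((z j)%:R - (u j)%:R / 2 ^+ t) +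
    \sum_j a i j * (1 - x j - 2 * (u j)%:R / 2 ^+ t).
  rewrite mulr_sumr -big_split; apply: eq_bigr => j _ /=.
  by case: (z j); rewrite ?expr1 ?expr0 /=; ring.
apply: le_trans (ler_normD _ _) _; rewrite normrM normrN [`|2|]ger0_norm//.
have h2 : `|\sum_j a i j * (1 - x j - 2 * (u j)%:R / 2 ^+ t)| <= D.
  apply: le_trans (ler_norm_sum _ _ _) _.
  apply: (@le_trans _ _ (\sum_(j : J) 2 / 2 ^+ t)).
    apply: ler_sum => j _; rewrite normrM -[leRHS]mul1r ler_pM//.
    have /andP[y0 y1] := y01 j.
    have : (u j)%:R <= 2 ^+ t * (1 - x j) / 2 by rewrite truncn_le.
    have : 2 ^+ t * (1 - x j) / 2 < (u j).+1%:R by exact: truncnS_gt.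
    rewrite -[(u j).+1%:R]natr1 => h1 h0.
    have -> : 1 - x j - 2 * (u j)%:R / 2 ^+ t =
        (2 ^+ t * (1 - x j) / 2 - (u j)%:R) * (2 / 2 ^+ t) by field; rewrite gt_eqF.
    have q0 : 0 <= 2 / 2 ^+ t :> R by rewrite divr_ge0// ltW.
    rewrite normrM (ger0_norm q0) ger0_norm; last by rewrite subr_ge0.
    by rewrite -[leRHS]mul1r ler_wpM2r//; lra.
  rewrite sumr_const -[leLHS]mulr_natr mulrAC ler_pdivrMr//.
  by rewrite [D * _]mulrC.
have q1 : 0 <= (2 ^+ t)^-1 :> R by rewrite invr_ge0 ltW.
have := zP i; nra.
Qed.

End Discrepancy.

(** * Trigonometric preliminaries *)

Section TrigBounds.
Local Open Scope classical_set_scope.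
Context {R : realType}.
Implicit Types x y : R.

Lemma derive_ge0_le0 (f df : R -> R) x :
  (forall y, is_derive y 1 f (df y)) -> (forall y, 0 <= y -> 0 <= df y) ->
  0 <= x -> f 0 <= f x.
Proof.
move=> fdf df0 x0.
have cf : {within `[0, x]%classic, continuous f}.
  apply: continuous_subspaceT => y; apply: differentiable_continuous.
  by apply/derivable1_diffP; have [] := fdf y.
have [c /itvP c0x E] := MVT_segment x0 (fun y _ => fdf y) cf.
by rewrite -subr_ge0 E mulr_ge0 ?df0 ?c0x// subr_ge0.
Qed.

Lemma sin_le x : 0 <= x -> sin x <= x.
Proof.
move=> x0; rewrite -subr_ge0.
have D y : is_derive y 1 (fun y => y - sin y) (1 - cos y) by apply: is_deriveB.
have := derive_ge0_le0 D _ x0.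
by rewrite sin0 subr0; apply => y _; rewrite subr_ge0 cos_le1.
Qed.

Lemma cos_ge x : 1 - x ^+ 2 / 2 <= cos x.
Proof.
wlog x0 : x / 0 <= x => [wl|].
  have [/wl//|/ltW x0] := leP 0 x.
  by rewrite -cosN -sqrrN wl// oppr_ge0.
suff : 0 <= cos x + (- 1 + (1 / 2) * x ^+ 2) by lra.
have D y : is_derive y 1 (fun y => cos y + (- 1 + (1 / 2) * y ^+ 2)) (- sin y + y).
  apply: is_derive_eq; rewrite ?scaler0 ?add0r ?addr0 ?expr1 ?scaler1 /GRing.scale /=; lra.
have := derive_ge0_le0 D _ x0.
rewrite cos0 expr0n /= mulr0 addr0 subrr; apply => y; first by move=> /sin_le; lra.
Qed.

Lemma sin_ge x : 0 <= x -> x - x ^+ 3 / 6 <= sin x.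
Proof.
move=> x0; suff : 0 <= sin x + (- x + (1 / 6) * x ^+ 3) by lra.
have D y : is_derive y 1 (fun y => sin y + (- y + (1 / 6) * y ^+ 3))
    (cos y - 1 + y ^+ 2 / 2).
  apply: is_derive_eq; rewrite ?scaler0 ?add0r ?addr0 ?expr1 ?scaler1 /GRing.scale /=; lra.
have := derive_ge0_le0 D _ x0.
rewrite sin0 expr0n /= mulr0 addr0 add0r oppr0; apply => y _; have := cos_ge y; lra.
Qed.

Lemma sin_ge_third x : 0 <= x <= 2 -> x / 3 <= sin x.
Proof. by move=> /andP[x0 x1]; apply: le_trans (sin_ge x0); nra. Qed.

Lemma sin_norm_le x : `|sin x| <= `|x|.
Proof.
wlog x0 : x / 0 <= x => [wl|].
  have [/wl//|/ltW x0] := leP 0 x.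
  by rewrite -normrN -sinN -[`|x|]normrN wl// oppr_ge0.
rewrite [`|x|]ger0_norm// ler_norml sin_le// andbT.
have [x2|/ltW x2] := leP x 2; last by have := sin_geN1 x; lra.
have : x / 3 <= sin x by apply: sin_ge_third; apply/andP.
lra.
Qed.

End TrigBounds.

(** * Unit complex numbers and sampling on a grid *)

Section Cis.
Context {R : realType}.
Implicit Types (x y : R) (z : R[i]).

Definition cis x : R[i] := cos x +i* sin x.
Arguments cis : simpl never.

Lemma cisD x y : cis (x + y) = cis x * cis y.
Proof. by rewrite /cis cosD sinD; simpc; congr (_ +i* _); ring. Qed.

Lemma cis0 : cis 0 = 1.
Proof. by rewrite /cis cos0 sin0. Qed.

Lemma cisN x : cis (- x) = conjc (cis x).
Proof. by rewrite /cis cosN sinN. Qed.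

Lemma cisX x n : cis x ^+ n = cis (n%:R * x).
Proof.
elim: n => [|n IH]; first by rewrite mul0r cis0.
by rewrite exprS IH -cisD -nat1r mulrDl mul1r.
Qed.

Lemma normc_sqr z : normc z ^+ 2 = complex.Re z ^+ 2 + complex.Im z ^+ 2.
Proof. by case: z => a b; rewrite /= sqr_sqrtr// addr_ge0 ?sqr_ge0. Qed.

Lemma normc_sqrC z : (normc z ^+ 2)%:C = z * conjc z.
Proof. by rewrite normc_sqr; case: z => a b; simpc; congr (_ +i* _); ring. Qed.

Lemma normc_ge0 z : 0 <= normc z.
Proof. by case: z => a b; apply: sqrtr_ge0. Qed.

Lemma normc_cis x : normc (cis x) = 1.
Proof. by rewrite /cis /= cos2Dsin2 sqrtr1. Qed.

Lemma normc_conj z : normc (conjc z) = normc z.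
Proof. by case: z => a b; rewrite /= sqrrN. Qed.

Lemma normc_real x : normc x%:C = `|x|.
Proof. by rewrite /= expr0n addr0 sqrtr_sqr. Qed.

Lemma normc_normE z : `|z| = (normc z)%:C.
Proof. by case: z. Qed.

Lemma normcD z1 z2 :
  normc (z1 + z2) <= normc z1 + normc z2.
Proof. by rewrite -(@lecR R) rmorphD /= -!normc_normE ler_normD. Qed.

Lemma normc_sum (I : Type) (r : seq I) (P : pred I) (F : I -> R[i]) :
  normc (\sum_(i <- r | P i) F i) <= \sum_(i <- r | P i) normc (F i).
Proof.
elim/big_rec2: _ => [|i a b _ h]; first by rewrite /= expr0n addr0 sqrtr0.
by apply: le_trans (normcD _ _) _; rewrite lerD2l.
Qed.

Lemma conjc_sum (I : Type) (r : seq I) (P : pred I) (F : I -> R[i]) :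
  conjc (\sum_(i <- r | P i) F i) = \sum_(i <- r | P i) conjc (F i).
Proof. exact: (rmorph_sum (@conjc R)). Qed.

Lemma Re_le_normc z : `|complex.Re z| <= normc z.
Proof. by case: z => a b /=; rewrite -sqrtr_sqr ler_wsqrtr// lerDl sqr_ge0. Qed.

Lemma Im_le_normc z : `|complex.Im z| <= normc z.
Proof. by case: z => a b /=; rewrite -sqrtr_sqr ler_wsqrtr// lerDr sqr_ge0. Qed.

Lemma normc_le_ReIm z : normc z <= `|complex.Re z| + `|complex.Im z|.
Proof.
case: z => a b; have -> : a +i* b = a%:C + b%:C * 'i by simpc.
apply: le_trans (normcD _ _) _.
by rewrite normcM !normc_real [normc 'i]/= expr0n add0r expr1n sqrtr1 mulr1; simpc.
Qed.

Lemma cis_neq1 x : 0 < `|x| < 2 * pi -> cis x != 1.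
Proof.
move=> /andP[x0 x1]; apply/eqP => -[c1 _].
have := cos_mulr2n (`|x| / 2); rewrite (_ : `|x| / 2 *+ 2 = `|x|); last by lra.
rewrite cos_norm c1 cos2sin2.
have : 0 < sin (`|x| / 2) by apply: sin_gt0_pi; lra.
by move=> s0; nra.
Qed.

Lemma sum_cis (G : nat) x : cis (G%:R * x) = 1 -> cis x != 1 ->
  \sum_(j < G) cis (j%:R * x) = 0.
Proof.
move=> xG x1; apply: (mulfI (x := cis x - 1)); first by rewrite subr_eq0.
have -> : \sum_(j < G) cis (j%:R * x) = \sum_(j < G) cis x ^+ j.
  by apply: eq_bigr => j _; rewrite cisX.
by rewrite -subrX1 cisX xG subrr mulr0.
Qed.

Definition grid (G j : nat) : R := 2 * pi * j%:R / G%:R.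

Lemma cis_grid_orthogonal (G b c : nat) : (b < G)%N -> (c < G)%N ->
  \sum_(j < G) cis (c%:R * grid G j) * cis (- (b%:R * grid G j)) =
  (if b == c then G%:R else 0).
Proof.
move=> bG cG; have G0 : 0 < G%:R :> R by rewrite ltr0n; apply: leq_ltn_trans bG.
have E j : cis (c%:R * grid G j) * cis (- (b%:R * grid G j)) =
    cis (j%:R * (2 * pi * (c%:R - b%:R) / G%:R)).
  by rewrite -cisD /grid; congr cis; field; rewrite gt_eqF.
under eq_bigr do rewrite E.
have [->|bc] := eqVneq b c.
  under eq_bigr do rewrite subrr mulr0 mul0r mulr0 cis0.
  by rewrite sumr_const card_ord.
apply: sum_cis.
  rewrite mulrC divfK ?gt_eqF//.
  have c2 (k : nat) : cis (2 * pi * k%:R) = 1.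
    by rewrite [2 * pi * _]mulrC -cisX /cis [2 * pi]mulr_natl cos2pi sin2pi expr1n.
  by rewrite mulrBr cisD c2 cisN c2 mul1r conjc1.
apply: cis_neq1; have p0 := @pi_gt0 R.
rewrite normrM normfV normrM (gtr0_norm G0) (gtr0_norm (_ : 0 < 2 * pi)); last by lra.
have d0 : 0 < `|c%:R - b%:R| :> R by rewrite normr_gt0 subr_eq0 eqr_nat eq_sym.
apply/andP; split; first by rewrite divr_gt0// mulr_gt0//; lra.
rewrite ltr_pdivrMr// ltr_pM2l; last by lra.
have : (b%:R < G%:R :> R) /\ (c%:R < G%:R :> R) by rewrite !ltr_nat.
have : (0 <= b%:R :> R) /\ (0 <= c%:R :> R) by [].
by move=> [? ?] [? ?]; rewrite ltr_norml; lra.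
Qed.

Lemma cis_grid_parseval (G B : nat) x : (B <= G)%N ->
  \sum_(j < G) normc (\sum_(b < B) cis (b%:R * (x - grid G j))) ^+ 2 =
  G%:R * B%:R.
Proof.
move=> BG; apply: complexI; rewrite rmorph_sum /=.
have E j : (normc (\sum_(b < B) cis (b%:R * (x - grid G j))) ^+ 2)%:C =
    \sum_(b < B) \sum_(c < B) cis ((b%:R - c%:R) * x) *
      (cis (c%:R * grid G j) * cis (- (b%:R * grid G j))).
  rewrite normc_sqrC conjc_sum mulr_suml; apply: eq_bigr => b _.
  rewrite mulr_sumr; apply: eq_bigr => c _.
  rewrite -cisN -!cisD; congr cis; ring.
under eq_bigr => j _ do rewrite E.
rewrite exchange_big /=.
under eq_bigr => b _.
  rewrite exchange_big /=.
  under eq_bigr => c _.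
    rewrite -mulr_sumr cis_grid_orthogonal ?(leq_trans _ BG)//.
  over.
  rewrite (bigD1 b)//= eqxx big1 => [|c cb]; last first.
    by rewrite ifN ?mulr0//; apply: contraNneq cb => /val_inj ->.
  rewrite subrr mul0r cis0 mul1r addr0.
over.
by rewrite sumr_const card_ord rmorphM /= !rmorph_nat mulr_natr.
Qed.

(* For each shift [a < m] the polynomial [z^a p(z)] has degree below [2m], so it is recovered
   from the grid by a Dirichlet kernel; averaging over [a] produces a product of two
   Dirichlet kernels, whose sum of moduli is bounded by Parseval. *)
Lemma grid_sup_le (m : nat) (d : nat -> R) (mu : R) (G := (2 * m)%N) : (0 < m)%N ->
  let p x : R[i] := \sum_(k < m) (d k)%:C * cis (k%:R * x) in
  (forall j : 'I_G, normc (p (grid G j)) <= mu) ->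
  forall x, normc (p x) <= 3 / 2 * mu.
Proof.
move=> m0 p pG x.
have G0 : 0 < G%:R :> R by rewrite ltr0n muln_gt0.
have m0R : 0 < m%:R :> R by rewrite ltr0n.
have mu0 : 0 <= mu.
  have GG : (0 < G)%N by rewrite muln_gt0.
  by apply: le_trans (pG (Ordinal GG)); exact: normc_ge0.
pose K B j := \sum_(b < B) cis (b%:R * (x - grid G j)).
have rep (a : 'I_m) : cis (a%:R * x) * p x * G%:R =
    \sum_(j < G) p (grid G j) * cis (a%:R * grid G j) * K G j.
  transitivity (\sum_(k < m) (d k)%:C * \sum_(b < G) cis (b%:R * x) *
      \sum_(j < G) cis ((a + k)%:R * grid G j) * cis (- (b%:R * grid G j))).
    rewrite /p mulr_sumr mulr_suml; apply: eq_bigr => k _.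
    have akG : (a + k < G)%N by have := ltn_ord a; have := ltn_ord k; rewrite /G; lia.
    rewrite (bigD1 (Ordinal akG))//= cis_grid_orthogonal// eqxx big1 => [|b ba].
      rewrite addr0 natrD mulrDl cisD; ring.
    rewrite cis_grid_orthogonal// ifN ?mulr0//.
  under eq_bigr => k _.
    rewrite mulr_sumr.
    under eq_bigr => b _ do rewrite !mulr_sumr.
    rewrite exchange_big /=.
  over.
  rewrite exchange_big /=; apply: eq_bigr => j _.
  rewrite /p -mulrA mulr_suml; apply: eq_bigr => k _.
  rewrite /K -!mulrA !mulr_sumr; apply: eq_bigr => b _.
  have -> : b%:R * (x - grid G j) = b%:R * x + - (b%:R * grid G j) by ring.
  by rewrite natrD [_ * grid G j]mulrDl !cisD; ring.
have avg : p x * (G%:R * m%:R) = \sum_(j < G) p (grid G j) * conjc (K m j) * K G j.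
  have -> : p x * (G%:R * m%:R) = \sum_(a < m) cis (- (a%:R * x)) * (cis (a%:R * x) * p x * G%:R).
    under eq_bigr => a _ do rewrite -mulrA mulrA -cisD addNr cis0 mul1r.
    by rewrite sumr_const card_ord -[RHS]mulr_natr mulrA.
  under eq_bigr => a _ do rewrite rep mulr_sumr.
  rewrite exchange_big /=; apply: eq_bigr => j _.
  rewrite mulrAC /K conjc_sum mulr_sumr; apply: eq_bigr => a _.
  rewrite -cisN.
  have -> : - (a%:R * (x - grid G j)) = - (a%:R * x) + a%:R * grid G j by ring.
  by rewrite cisD; ring.
have := congr1 (@normc R) avg.
rewrite normcM -natrM -[in X in _ * X](rmorph_nat (@real_complex R)) normc_real.
rewrite normr_nat natrM => E.
have : normc (p x) * (G%:R * m%:R) <= 3 / 2 * mu * (G%:R * m%:R).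
  rewrite E; apply: le_trans (normc_sum _ _ _) _.
  (* Parseval after [u * v <= (u ^+ 2 + v ^+ 2) / 2]: the squares sum to [G * m] and to
     [G * G = 2 * G * m], whence the factor 3/2. *)
  have -> : 3 / 2 * mu * (G%:R * m%:R) =
      mu / 2 * (\sum_(j < G) normc (K m j) ^+ 2 + \sum_(j < G) normc (K G j) ^+ 2).
    by rewrite !cis_grid_parseval ?leq_pmull// /G natrM; field.
  rewrite -big_split mulr_sumr; apply: ler_sum => j _ /=.
  rewrite !normcM normc_conj.
  have := pG j; have := normc_ge0 (p (grid G j)).
  have := normc_ge0 (K m j); have := normc_ge0 (K G j).
  set u := normc _; set v := normc _; set w := normc _.
  move=> u0 v0 w0 wmu; apply: (@le_trans _ _ (mu * (v * u))).
    by rewrite -mulrA ler_wpM2r ?mulr_ge0.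
  have := sqr_ge0 (u - v); nra.
by rewrite ler_pM2r// mulr_gt0.
Qed.

End Cis.

(** * Rudin-Shapiro polynomials *)

Section RudinShapiro.
Context {R : realType}.
Implicit Types (x y : R) (t : nat).

Lemma normc_cisB x y : normc (cis x - cis y) <= `|x - y|.
Proof.
have p0 : 0 <= normc (cis x - cis y) by exact: normc_ge0.
rewrite -(@ler_pXn2r _ 2) ?nnegrE//.
have -> : normc (cis x - cis y) ^+ 2 = (2 * sin ((x - y) / 2)) ^+ 2.
  rewrite normc_sqr /cis /=.
  have cc := cos_mulr2n ((x - y) / 2).
  rewrite (_ : (x - y) / 2 *+ 2 = x - y) in cc; last by lra.
  have := cos2Dsin2 x; have := cos2Dsin2 y; have := cos2Dsin2 ((x - y) / 2).
  have := cosB x y.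
  set s := sin (_ / 2); set c := cos (_ / 2) in cc *.
  rewrite cc; nra.
rewrite -[leLHS]real_normK ?num_real// ler_pXn2r ?nnegrE// normrM.
have -> : `|x - y| = `|2| * `|(x - y) / 2| by rewrite -normrM; congr `|_|; lra.
by rewrite ler_wpM2l// sin_norm_le.
Qed.

Lemma normc_sqrD (a b : R[i]) :
  normc (a + b) ^+ 2 + normc (a - b) ^+ 2 = 2 * (normc a ^+ 2 + normc b ^+ 2).
Proof. by rewrite !normc_sqr; case: a => a1 a2; case: b => b1 b2 /=; ring. Qed.

Fixpoint rs t : (nat -> R) * (nat -> R) :=
  if t is t'.+1 then
    (fun k => if (k < 2 ^ t')%N then (rs t').1 k else (rs t').2 (k - 2 ^ t')%N,
     fun k => if (k < 2 ^ t')%N then (rs t').1 k else - (rs t').2 (k - 2 ^ t')%N)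
  else (fun=> 1, fun=> 1).

Definition trigp (c : nat -> R) (n : nat) x : R[i] := \sum_(k < n) (c k)%:C * cis (k%:R * x).

Definition rsP t x := trigp (rs t).1 (2 ^ t) x.
Definition rsQ t x := trigp (rs t).2 (2 ^ t) x.

Lemma rs_sign t k : ((rs t).1 k = 1 \/ (rs t).1 k = -1) /\ ((rs t).2 k = 1 \/ (rs t).2 k = -1).
Proof.
elim: t k => [|t IH] k /=; first by split; left.
have [h1 _] := IH k; have [_ h2] := IH (k - 2 ^ t)%N.
by case: ifP => _; split=> //; case: h2 => ->; rewrite ?opprK; [right|left].
Qed.

Lemma trigp1 (c : nat -> R) x : trigp c 1 x = (c 0%N)%:C.
Proof. by rewrite /trigp big_ord1 mul0r cis0 mulr1. Qed.

Lemma trigp_cat (c d : nat -> R) n x :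
  trigp (fun k => if (k < n)%N then c k else d (k - n)%N) (n + n) x =
  trigp c n x + cis (n%:R * x) * trigp d n x.
Proof.
rewrite /trigp big_split_ord /=; congr (_ + _).
  by apply: eq_bigr => k _; rewrite ltn_ord.
rewrite mulr_sumr; apply: eq_bigr => k _.
by rewrite ltnNge leq_addr addKn natrD mulrDl cisD; ring.
Qed.

Lemma rsPS t x : rsP t.+1 x = rsP t x + cis ((2 ^ t)%:R * x) * rsQ t x.
Proof. by rewrite /rsP expnS mul2n -addnn trigp_cat. Qed.

Lemma rsQS t x : rsQ t.+1 x = rsP t x - cis ((2 ^ t)%:R * x) * rsQ t x.
Proof.
rewrite /rsQ expnS mul2n -addnn (trigp_cat _ (fun k => - (rs t).2 k)) -mulrN.
congr (_ + _ * _); rewrite /trigp -sumrN; apply: eq_bigr => k _.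
by rewrite rmorphN mulNr.
Qed.

(** By the parallelogram law each step of the recursion doubles the sum; in particular the pair is
    never small at the same point. *)
Lemma rs_normc t x : normc (rsP t x) ^+ 2 + normc (rsQ t x) ^+ 2 = 2 ^+ t.+1.
Proof.
elim: t => [|t IH].
  by rewrite /rsP /rsQ expn0 !trigp1 normc1 !expr1n.
by rewrite rsPS rsQS normc_sqrD normcM normc_cis mul1r IH -exprS.
Qed.

Lemma rs_normc_le t x :
  normc (rsP t x) <= Num.sqrt (2 ^+ t.+1) /\ normc (rsQ t x) <= Num.sqrt (2 ^+ t.+1).
Proof.
have := rs_normc t x; have := normc_ge0 (rsP t x); have := normc_ge0 (rsQ t x).
move=> q0 p0 <-; split.
  by rewrite -[leLHS]ger0_norm// -sqrtr_sqr ler_wsqrtr// lerDl sqr_ge0.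
by rewrite -[leLHS]ger0_norm// -sqrtr_sqr ler_wsqrtr// lerDr sqr_ge0.
Qed.

(** A Bernstein inequality by induction. With [C] in place of the constant 2, a step needs
    [2 C + 1 <= 2 sqrt 2 C], the 1 coming from the rotating factor in front of [rsQ]; for [C = 2]
    the estimate [7/5 <= sqrt 2] suffices. *)
Lemma rs_lipschitz t x y :
  normc (rsP t x - rsP t y) <= 2 * 2 ^+ t * Num.sqrt (2 ^+ t.+1) * `|x - y| /\
  normc (rsQ t x - rsQ t y) <= 2 * 2 ^+ t * Num.sqrt (2 ^+ t.+1) * `|x - y|.
Proof.
elim: t => [|t [IHp IHq]].
  rewrite /rsP /rsQ expn0 !trigp1 !subrr normc0.
  by split; rewrite !mulr_ge0 ?sqrtr_ge0 ?exprn_ge0.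
set w := cis ((2 ^ t)%:R * x); set v := cis ((2 ^ t)%:R * y).
set s : R := Num.sqrt (2 ^+ t.+1); set s' : R := Num.sqrt (2 ^+ t.+2).
have s0 : 0 <= s by exact: sqrtr_ge0.
have ss : 7 * s <= 5 * s'.
  rewrite -(@ler_pXn2r _ 2) ?nnegrE ?mulr_ge0 ?sqrtr_ge0// !exprMn !sqr_sqrtr ?exprn_ge0//.
  by rewrite [2 ^+ t.+2]exprS; have := exprn_ge0 t.+1 (ler0n R 2); lra.
have wQ : normc (w * rsQ t x - v * rsQ t y) <=
    2 ^+ t * `|x - y| * s + 2 * 2 ^+ t * s * `|x - y|.
  have -> : w * rsQ t x - v * rsQ t y = (w - v) * rsQ t x + v * (rsQ t x - rsQ t y) by ring.
  apply: le_trans (normcD _ _) _; rewrite !normcM normc_cis mul1r lerD//.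
  apply: ler_pM; rewrite ?normc_ge0//; last by have [] := rs_normc_le t x.
  apply: le_trans (normc_cisB _ _) _; by rewrite -mulrBr normrM natrX ger0_norm// exprn_ge0.
have X0 : 0 <= 2 ^+ t * `|x - y| by rewrite mulr_ge0 ?exprn_ge0.
have fin : 2 * 2 ^+ t * s * `|x - y| + (2 ^+ t * `|x - y| * s + 2 * 2 ^+ t * s * `|x - y|) <=
    2 * 2 ^+ t.+1 * s' * `|x - y|.
  have := ler_wpM2l X0 ss; rewrite exprS; set X := 2 ^+ t; set Y := `|_|.
  by have := mulr_ge0 X0 s0; rewrite -/X -/Y; nra.
split.
  rewrite !rsPS -/w -/v opprD addrACA; apply: le_trans (normcD _ _) _.
  by apply: le_trans fin; rewrite lerD.
rewrite !rsQS -/w -/v.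
have -> : rsP t x - w * rsQ t x - (rsP t y - v * rsQ t y) =
  (rsP t x - rsP t y) - (w * rsQ t x - v * rsQ t y) by ring.
apply: le_trans (normcD _ _) _; rewrite normcN.
by apply: le_trans fin; rewrite lerD.
Qed.

(* At [z = 1] and [z = -1] the recursion becomes (P, Q) -> (P + Q, P - Q), which doubles both
   entries every two steps. *)
Lemma rs_odd_values t :
  [/\ rsP t.*2.+1 0 = (2 ^+ t.+1)%:C, rsQ t.*2.+1 0 = 0,
      rsP t.*2.+1 pi = 0 & rsQ t.*2.+1 pi = (2 ^+ t.+1)%:C].
Proof.
have E x : rsP 0 x = 1 /\ rsQ 0 x = 1.
  by rewrite /rsP /rsQ expn0 !trigp1.
have cpi (n : nat) : cis ((2 ^ n.+1)%:R * pi : R) = 1.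
  rewrite expnS natrM mulrAC mulrC -cisX /cis mulr_natl cos2pi sin2pi; exact: expr1n.
have cpi1 : cis (pi : R) = -1 by rewrite /cis cospi sinpi; simpc.
elim: t => [|t [p0 q0 p1 q1]].
  rewrite !rsPS !rsQS; have [-> ->] := E 0; have [-> ->] := E pi.
  have e2 : (2 ^+ 1)%:C = 1 + 1 :> R[i] by rewrite expr1 rmorph_nat.
  by rewrite expn0 mulr0 mul1r cis0 cpi1 mul1r mulN1r opprK subrr e2.
rewrite doubleS; do 2 rewrite ?(rsPS _.+1) ?(rsQS _.+1).
rewrite !mulr0 !cis0 !cpi !mul1r p0 q0 p1 q1 !(addr0, add0r, subr0, subrr, sub0r, opprK).
by split=> //; rewrite [2 ^+ t.+2]exprS mulr2n mulrDl mul1r rmorphD.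
Qed.

End RudinShapiro.

(** * The cosine part is small at few separated points of a window *)

Section Density.
Context {R : realType}.
Implicit Types (x y : R) (t : nat).

(* Dividing by ['X - x0] passes to one node less and costs a factor [5 / sg]. *)
Lemma coef_le_of_nodes (sg : R) (s : seq R[i]) (p : {poly R[i]}) (e : R) :
  0 < sg <= 1 -> 0 <= e -> pairwise (fun u v => sg <= normc (u - v)) s ->
  (forall z, z \in s -> normc z <= 1 /\ normc p.[z] <= e) ->
  (size p <= size s)%N -> forall i, normc p`_i <= (5 / sg) ^+ size s * e.
Proof.
move=> /andP[sg0 sg1]; elim: s p e => [|x0 s IH] p e e0 /=.
  move=> _ _; rewrite leqn0 size_poly_eq0 => /eqP -> i.
  by rewrite coef0 normc0 expr0 mul1r.
move=> /andP[/allP sep0 sep] pe sz i.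
have [x01 pe0] := pe x0 (mem_head _ _).
have /factor_theorem[q qE] : root (p - p.[x0]%:P) x0 by rewrite /root !hornerE subrr.
have pE : p = p.[x0]%:P + q * ('X - x0%:P) by rewrite -qE addrC subrK.
have szq : (size q <= size s)%N.
  have [->|q0] := eqVneq q 0; first by rewrite size_poly0.
  have : (size (q * ('X - x0%:P))%R <= (size s).+1)%N.
    rewrite -qE; apply: leq_trans (size_polyD _ _) _; rewrite geq_max sz size_polyN.
    by apply: leq_trans (size_polyC_leq1 _) _.
  by rewrite size_Mmonic ?monicXsubC// size_XsubC addn2.
have bq : forall j, normc q`_j <= (5 / sg) ^+ size s * (2 * e / sg).
  apply: IH => // [|x xs]; first by rewrite !mulr_ge0 ?invr_ge0 ?(ltW sg0).
  have [x1 px] := pe x (mem_behead (s := x0 :: s) xs); split=> //.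
  have d := sep0 _ xs.
  have : normc q.[x] * normc (x0 - x) <= 2 * e.
    rewrite -normcM -normcN -mulrN opprB.
    have -> : q.[x] * (x - x0) = p.[x] - p.[x0].
      by have := congr1 (fun r => r.[x]) qE; rewrite !hornerE => ->.
    by apply: le_trans (normcD _ _) _; rewrite normcN; lra.
  rewrite ler_pdivlMr//; apply: le_trans; rewrite ler_wpM2l ?normc_ge0//.
have A0 : 0 <= (5 / sg) ^+ size s * (2 * e / sg).
  by rewrite !mulr_ge0 ?exprn_ge0 ?divr_ge0 ?invr_ge0 ?(ltW sg0).
rewrite pE coefD mulrBr coefB coefMX coefMC coefC.
apply: le_trans (normcD _ _) _.
have h1 : normc (if i == 0%N then p.[x0] else 0) <= e by case: ifP; rewrite ?normc0.
have h2 : normc (if i == 0%N then 0 else q`_i.-1) <= (5 / sg) ^+ size s * (2 * e / sg).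
  by case: ifP; rewrite ?normc0.
have h3 : normc (q`_i * x0) <= (5 / sg) ^+ size s * (2 * e / sg).
  by rewrite normcM -[leRHS]mulr1 ler_pM ?normc_ge0.
have h4 := normcD (if i == 0%N then 0 else q`_i.-1) (- (q`_i * x0)).
rewrite normcN in h4.
have h5 : e <= (5 / sg) ^+ size s * (e / sg).
  have g1 : 1 <= 5 / sg by rewrite ler_pdivlMr//; lra.
  rewrite -[leLHS]mul1r ler_pM// ?exprn_ege1//.
  by rewrite ler_pdivlMr// -[leRHS]mulr1 ler_wpM2l.
rewrite exprS.
have -> : 5 / sg * (5 / sg) ^+ size s * e = 5 * ((5 / sg) ^+ size s * (e / sg)).
  by rewrite -!mulrA; ring.
have E : (5 / sg) ^+ size s * (2 * e / sg) = 2 * ((5 / sg) ^+ size s * (e / sg)) by ring.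
rewrite E in h2 h3; lra.
Qed.

Lemma normc_cisB_ge x y : `|x - y| <= pi -> `|x - y| / 3 <= normc (cis x - cis y).
Proof.
move=> d; have p0 : 0 <= normc (cis x - cis y) by exact: normc_ge0.
have d0 : 0 <= `|x - y| by [].
rewrite -(@ler_pXn2r _ 2) ?nnegrE ?divr_ge0//.
have -> : normc (cis x - cis y) ^+ 2 = (2 * sin (`|x - y| / 2)) ^+ 2.
  rewrite normc_sqr /cis /=.
  have cc := cos_mulr2n (`|x - y| / 2).
  rewrite (_ : `|x - y| / 2 *+ 2 = `|x - y|) in cc; last by lra.
  rewrite cos_norm in cc.
  have := cos2Dsin2 x; have := cos2Dsin2 y; have := cos2Dsin2 (`|x - y| / 2).
  have := cosB x y.
  set s := sin (_ / 2); set c := cos (_ / 2) in cc *.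
  rewrite cc; nra.
have := @pihalf_02 R => /andP[_ p2].
have : `|x - y| / 2 / 3 <= sin (`|x - y| / 2) by apply: sin_ge_third; lra.
by move=> h; apply: lerXn2r; rewrite ?nnegrE; lra.
Qed.

Definition rs_cosine t (T : nat) x : R :=
  complex.Re (cis (T%:R * x) * rsP t x + cis ((2 * T)%:R * x) * rsQ t x).

(* On a window of length [pi / T] the polynomials [P] and [Q] are nearly constant, so
   [rs_cosine] is close to [Re (p w + q w^2)] with [w] on the unit circle; [2 w^2] times this
   is a polynomial of degree 4 in [w] and cannot be small at five separated points. *)
Lemma rs_cosine_five t (T : nat) (sg e : R) (s : seq R) (S : R := Num.sqrt (2 ^+ t.+1)) :
  (0 < T)%N -> 0 < sg <= 3 -> 0 <= e -> size s = 5%N ->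
  pairwise (fun x y => sg <= T%:R * `|x - y| <= pi) s ->
  (forall x, x \in s -> `|rs_cosine t T x| <= e * S) ->
  1 < (15 / sg) ^+ 5 * (4 * (e + 4 * 2 ^+ t * pi / T%:R)).
Proof.
move=> T0 /andP[sg0 sg3] e0; case: s => // x0 s ss sep bad; rewrite ltNge; apply/negP => hK.
have TR0 : 0 < T%:R :> R by rewrite ltr0n.
have S0 : 0 < S by rewrite sqrtr_gt0 exprn_gt0.
pose p := rsP t x0; pose q := rsQ t x0.
pose k := 2 * 2 ^+ t * pi / T%:R : R.
pose w x := cis (T%:R * x) : R[i].
pose h : {poly R[i]} := \poly_(i < 5) nth 0 [:: conjc q; conjc p; 0; p; q] i.
have pip : 0 <= (pi : R) by exact: pi_ge0.
have nw x : normc (w x) = 1 by exact: normc_cis.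
have nw2 x : normc (w x ^+ 2) = 1 by rewrite /w cisX normc_cis.
have near x : x \in x0 :: s -> normc (rsP t x - p) <= k * S /\ normc (rsQ t x - q) <= k * S.
  move=> xs; have d : `|x - x0| <= pi / T%:R.
    rewrite ler_pdivlMr// mulrC; move: xs; rewrite inE => /predU1P[->|xs].
      by rewrite subrr normr0 mulr0.
    by move: sep => /= /andP[/allP /(_ _ xs)]; rewrite distrC => /andP[].
  have [h1 h2] := rs_lipschitz t x x0.
  have hk : 2 * 2 ^+ t * S * `|x - x0| <= k * S.
    rewrite /k mulrAC ler_wpM2r ?(ltW S0)// -[leRHS]mulrA ler_wpM2l//.
    by rewrite mulr_ge0 ?exprn_ge0.
  by split; apply: le_trans hk.
have frozen x : x \in x0 :: s -> `|complex.Re (p * w x + q * w x ^+ 2)| <= (e + 2 * k) * S.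
  move=> xs; have [n1 n2] := near x xs.
  have -> : complex.Re (p * w x + q * w x ^+ 2) = rs_cosine t T x -
      complex.Re ((rsP t x - p) * w x + (rsQ t x - q) * w x ^+ 2).
    have w2 : cis ((2 * T)%:R * x) = w x ^+ 2 by rewrite /w cisX natrM mulrA.
    have ReB (a b : R[i]) : complex.Re a - complex.Re b = complex.Re (a - b).
      by case: a; case: b.
    by rewrite /rs_cosine w2 -/(w x) ReB; congr complex.Re; ring.
  apply: le_trans (ler_normB _ _) _; have := bad x xs.
  have : `|complex.Re ((rsP t x - p) * w x + (rsQ t x - q) * w x ^+ 2)| <= 2 * k * S.
    apply: le_trans (Re_le_normc _) _; apply: le_trans (normcD _ _) _.
    by rewrite (normcM _ (w x)) (normcM _ (w x ^+ 2)) nw nw2 !mulr1; lra.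
  lra.
have hw x : x \in x0 :: s -> normc h.[w x] <= 2 * ((e + 2 * k) * S).
  move=> xs; have := frozen x xs.
  have -> : h.[w x] = w x ^+ 2 * (2 * complex.Re (p * w x + q * w x ^+ 2))%:C.
    have wc : w x * conjc (w x) = 1 by rewrite -normc_sqrC nw expr1n.
    have -> : (2 * complex.Re (p * w x + q * w x ^+ 2))%:C =
      (p * w x + q * w x ^+ 2) + (conjc p * conjc (w x) + conjc q * conjc (w x) ^+ 2).
      have cM := rmorphM (@conjc R); have cD := rmorphD (@conjc R).
      rewrite !expr2 -!cM -cD; case: (_ + _ : R[i]) => a b.
      by apply/eqP; rewrite eq_complex /=; apply/andP; split; apply/eqP; lra.
    rewrite /h horner_poly !big_ord_recl big_ord0 /=.
    have alg (a b c d u v : R[i]) : u * v = 1 ->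
        u ^+ 2 * (c * u + d * u ^+ 2 + (b * v + a * v ^+ 2)) =
        a + b * u + c * u ^+ 3 + d * u ^+ 4.
      move=> uv; transitivity (c * u ^+ 3 + d * u ^+ 4 + b * u * (u * v) + a * (u * v) ^+ 2).
        by ring.
      by rewrite uv; ring.
    by rewrite (alg _ _ _ _ _ _ wc) /bump /= expr0 expr1 mulr1 mul0r add0r addr0 !addrA.
  by move=> hf; rewrite normcM normc_real nw2 mul1r normrM ger0_norm// ler_wpM2l.
have coefs : forall i, normc h`_i <= (5 / (sg / 3)) ^+ 5 * (2 * ((e + 2 * k) * S)).
  have := @coef_le_of_nodes (sg / 3) (map w (x0 :: s)) h (2 * ((e + 2 * k) * S)).
  have ek0 : 0 <= 2 * ((e + 2 * k) * S).
    by rewrite !mulr_ge0 ?addr_ge0 ?mulr_ge0 ?exprn_ge0 ?invr_ge0 ?(ltW TR0) ?(ltW S0).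
  rewrite size_map ss; apply => //.
  - by rewrite divr_gt0//=; lra.
  - rewrite pairwise_map; apply: sub_pairwise sep => x y /andP[d1 d2] /=.
    have E : T%:R * `|x - y| = `|T%:R * x - T%:R * y|.
      by rewrite -mulrBr normrM ger0_norm// ltW.
    rewrite E in d1 d2; apply: le_trans (normc_cisB_ge d2).
    by rewrite ler_pM2r ?invr_gt0.
  - by move=> _ /mapP[x xs ->]; split; [rewrite normc_cis|exact: hw].
  - exact: size_poly.
have c3 := coefs 3%N; have c4 := coefs 4%N.
have h3 : h`_3 = p by rewrite /h coef_poly.
have h4 : h`_4 = q by rewrite /h coef_poly.
rewrite h3 in c3; rewrite h4 in c4.
have K : (5 / (sg / 3)) ^+ 5 * (2 * ((e + 2 * k) * S)) <= S / 2.
  have -> : 5 / (sg / 3) = 15 / sg by field; rewrite gt_eqF.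
  have -> : (15 / sg) ^+ 5 * (2 * ((e + 2 * k) * S)) =
    (15 / sg) ^+ 5 * (4 * (e + 4 * 2 ^+ t * pi / T%:R)) * (S / 2).
    by rewrite /k; field; rewrite !gt_eqF.
  by rewrite -[leRHS]mul1r ler_wpM2r// divr_ge0// ltW.
(* The coefficients [p] and [q] of [h] would both have modulus at most [S / 2], against
   [normc p ^+ 2 + normc q ^+ 2 = S ^+ 2]. *)
have := rs_normc t x0; rewrite -/p -/q.
have -> : 2 ^+ t.+1 = S ^+ 2 by rewrite /S sqr_sqrtr ?exprn_ge0.
have := normc_ge0 p; have := normc_ge0 q; nra.
Qed.

End Density.

(** * Sine polynomials that are large on prescribed cells *)

Section OddKernel.
Context {R : realType}.
Implicit Types (x y th a : R) (M : nat).

(** This is [cos x] times the Fejer kernel in [2 * x], normalised to 1 at 0. The shift by 1 makes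
    every frequency odd, hence disjoint from those of the cosine part. *)
Definition odd_kernel M x : R :=
  (\sum_(j < M) \sum_(i < M) cos ((2 * j%:R - 2 * i%:R + 1) * x)) / M%:R ^+ 2.

Definition dirichlet M x : R[i] := \sum_(j < M) cis (j%:R * (2 * x)).

Lemma Re_sum (I : Type) (r : seq I) (P : pred I) (F : I -> R[i]) :
  complex.Re (\sum_(i <- r | P i) F i) = \sum_(i <- r | P i) complex.Re (F i).
Proof. by elim/big_rec2: _ => // i _ z _ <-; case: z (F i) => [? ?] [? ?]. Qed.

Lemma odd_kernelE M x :
  odd_kernel M x = cos x * (normc (dirichlet M x) ^+ 2 / M%:R ^+ 2).
Proof.
have -> : normc (dirichlet M x) ^+ 2 =
    \sum_(j < M) \sum_(i < M) cos ((2 * j%:R - 2 * i%:R) * x).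
  have := congr1 (@complex.Re R) (normc_sqrC (dirichlet M x)); rewrite [LHS]/= => ->.
  rewrite /dirichlet conjc_sum mulr_suml Re_sum; apply: eq_bigr => j _.
  rewrite mulr_sumr Re_sum; apply: eq_bigr => i _.
  by rewrite -cisN -cisD; congr cos; ring.
rewrite /odd_kernel mulrA; congr (_ / _).
set S := (LHS).
(* Exchanging [j] and [i] turns the shift [+ 1] into [- 1], as [cos] is even; averaging the two
   forms pulls out the factor [cos x]. *)
have S2 : S = \sum_(j < M) \sum_(i < M) cos ((2 * j%:R - 2 * i%:R - 1) * x).
  rewrite /S exchange_big; apply: eq_bigr => j _; apply: eq_bigr => i _ /=.
  by rewrite -cosN; congr cos; ring.
suff : 2 * S = 2 * (cos x * \sum_(j < M) \sum_(i < M) cos ((2 * j%:R - 2 * i%:R) * x)).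
  by move=> h; lra.
rewrite mulr2n mulrDl mul1r {2}S2 /S -big_split 2!mulr_sumr /=.
apply: eq_bigr => j _; rewrite -big_split 2!mulr_sumr; apply: eq_bigr => i _ /=.
set u := 2 * j%:R - 2 * i%:R.
have -> : (u + 1) * x = u * x + x by ring.
have -> : (u - 1) * x = u * x - x by ring.
by rewrite cosD cosB; ring.
Qed.

Lemma normc_dirichlet_le M x : normc (dirichlet M x) <= M%:R.
Proof.
apply: le_trans (normc_sum _ _ _) _.
by under eq_bigr do rewrite normc_cis; rewrite sumr_const card_ord.
Qed.

Lemma dirichlet_sin M x : normc (dirichlet M x) * `|sin x| <= 1.
Proof.
have E : dirichlet M x * (cis (2 * x) - 1) = cis (M%:R * (2 * x)) - 1.
  rewrite -(cisX (2 * x) M) subrX1 [RHS]mulrC /dirichlet; congr (_ * _).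
  by apply: eq_bigr => j _; rewrite cisX.
have : normc (dirichlet M x) * normc (cis (2 * x) - 1) <= 2.
  rewrite -normcM E; apply: le_trans (normcD _ _) _.
  by rewrite normc_cis normcN normc1; lra.
have -> : normc (cis (2 * x) - 1) = 2 * `|sin x|.
  have p0 := normc_ge0 (cis (2 * x) - 1).
  have q0 : 0 <= 2 * `|sin x| by rewrite mulr_ge0.
  apply/eqP; rewrite -(@eqrXn2 _ 2)//; apply/eqP.
  rewrite normc_sqr exprMn real_normK ?num_real// /cis /=.
  rewrite mulr_natl cos_mulr2n sin_mulr2n.
  by have := cos2Dsin2 x; set c := cos x; set s := sin x => h; nra.
by move=> h; lra.
Qed.

Lemma odd_kernel_le1 M x : (0 < M)%N -> `|odd_kernel M x| <= 1.
Proof.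
move=> M0; rewrite odd_kernelE normrM -[leRHS]mul1r ler_pM// ?cos_max//.
have MR : 0 < M%:R :> R by rewrite ltr0n.
rewrite ger0_norm ?divr_ge0 ?sqr_ge0// ler_pdivrMr ?exprn_gt0// mul1r.
by rewrite lerXn2r ?nnegrE ?normc_ge0 ?normc_dirichlet_le.
Qed.

Lemma odd_kernel_ge0 M x : 0 <= cos x -> 0 <= odd_kernel M x.
Proof. by move=> c0; rewrite odd_kernelE mulr_ge0 ?divr_ge0 ?sqr_ge0. Qed.

Lemma odd_kernel_sin M x : (0 < M)%N ->
  `|odd_kernel M x| * (M%:R * sin x) ^+ 2 <= 1.
Proof.
move=> M0; have MR : 0 < M%:R :> R by rewrite ltr0n.
rewrite odd_kernelE normrM [`|_ / _|]ger0_norm ?divr_ge0 ?sqr_ge0//.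
have -> : `|cos x| * (normc (dirichlet M x) ^+ 2 / M%:R ^+ 2) * (M%:R * sin x) ^+ 2 =
  `|cos x| * (normc (dirichlet M x) * `|sin x|) ^+ 2.
  by rewrite !exprMn real_normK ?num_real//; field; rewrite gt_eqF.
rewrite -[leRHS]mul1r ler_pM ?sqr_ge0 ?cos_max//.
by rewrite expr_le1 ?dirichlet_sin ?mulr_ge0 ?normc_ge0.
Qed.

Lemma odd_kernel_ge_half M x : (0 < M)%N -> M%:R * `|x| <= 1 / 8 -> 1 / 2 <= odd_kernel M x.
Proof.
move=> M0 Mx; have MR : 1 <= M%:R :> R by rewrite ler1n.
have x0 : 0 <= `|x| by [].
have x8 : `|x| <= 1 / 8 by nra.
have c1 : 31 / 32 <= cos x.
  by rewrite -cos_norm; apply: le_trans (cos_ge _); nra.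
have d1 : 15 / 16 * M%:R <= normc (dirichlet M x).
  apply: le_trans (Re_le_normc _); apply: le_trans (ler_norm _); rewrite Re_sum.
  have -> : 15 / 16 * M%:R = \sum_(j < M) (15 / 16 : R) by rewrite sumr_const card_ord mulr_natr.
  apply: ler_sum => j _; rewrite /= -cos_norm; apply: le_trans (cos_ge _).
  have jM : j%:R <= M%:R :> R by rewrite ler_nat ltnW.
  have : `|j%:R * (2 * x)| <= 1 / 4.
    rewrite !normrM (ger0_norm (ler0n R j)) (ger0_norm (ler0n R 2)).
    have : j%:R * `|x| <= M%:R * `|x| by rewrite ler_wpM2r.
    lra.
  have : 0 <= `|j%:R * (2 * x)| by []; nra.
rewrite odd_kernelE.
have : (15 / 16) ^+ 2 <= normc (dirichlet M x) ^+ 2 / M%:R ^+ 2.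
  rewrite ler_pdivlMr ?exprn_gt0//; last lra.
  by rewrite -exprMn lerXn2r ?nnegrE ?normc_ge0//; lra.
by move=> h; nra.
Qed.

(* [absd j i] is [|2 (j - i) + 1|]. *)
Definition absd (j i : nat) : nat := ((2 * j + 1 - 2 * i) + (2 * i - (2 * j + 1)))%N.

Definition absd_count M (k : nat) : nat := #|[set u : 'I_M * 'I_M | absd u.1 u.2 == k]|.

Lemma absd_count_even M k : ~~ odd k -> absd_count M k = 0%N.
Proof.
move=> ek; apply: eq_card0 => -[j i]; rewrite !inE /=; apply/negbTE.
by apply: contraNneq ek => <-; rewrite /absd; lia.
Qed.

(** Once the absolute value is fixed, a pair is determined by [i] and the side on which [j] lies. *)
Lemma absd_count_le M k : (absd_count M k <= 2 * M)%N.
Proof.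
pose f (u : 'I_M * 'I_M) := (u.2, (u.2 <= u.1)%N).
have finj : {in [set u : 'I_M * 'I_M | absd u.1 u.2 == k] &, injective f}.
  move=> [j i] [j' i']; rewrite !inE /= => /eqP h /eqP h' [ii' b].
  rewrite -ii' in h' b *; congr (_, _); apply/val_inj => /=.
  by move: h h' b; rewrite /absd; case: leqP; case: leqP => //; lia.
rewrite /absd_count -(card_in_imset finj); apply: leq_trans (max_card _) _.
by rewrite card_prod card_ord card_bool mulnC.
Qed.

Definition kernel_coef M (k : nat) : R := 2 * (absd_count M k)%:R / M%:R ^+ 2.

Lemma kernel_coef_le M k : (0 < M)%N -> 0 <= kernel_coef M k <= 4 / M%:R.
Proof.
move=> M0; have MR : 0 < M%:R :> R by rewrite ltr0n.
apply/andP; split; first by rewrite divr_ge0 ?mulr_ge0 ?sqr_ge0.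
rewrite /kernel_coef ler_pdivrMr ?exprn_gt0// expr2 mulrA divfK ?gt_eqF//.
have := absd_count_le M k; rewrite -(ler_nat R) natrM => h; lra.
Qed.

Lemma kernel_coef_even M k : ~~ odd k -> kernel_coef M k = 0.
Proof. by move=> ek; rewrite /kernel_coef absd_count_even// mulr0 mul0r. Qed.

(** A bump minus its mirror image is a pure sine polynomial in [th]. A product of two sines is even
    in the frequency, so terms may be grouped by [absd]; each coefficient is [sin (k a)] times a
    factor free of [a], so sums of signed bumps have signed sums of sines as coefficients. *)
Lemma odd_kernel_sub M th a :
  odd_kernel M (th - a) - odd_kernel M (th + a) =
  \sum_(k < 2 * M) kernel_coef M k * sin (k%:R * th) * sin (k%:R * a).
Proof.
have kap (j i : 'I_M) : (absd j i < 2 * M)%N.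
  by have := ltn_ord j; have := ltn_ord i; rewrite /absd; lia.
transitivity (\sum_(u : 'I_M * 'I_M)
    2 * (sin ((absd u.1 u.2)%:R * th) * sin ((absd u.1 u.2)%:R * a)) / M%:R ^+ 2).
  rewrite /odd_kernel -mulrBl pair_bigA pair_bigA -sumrB mulr_suml /=.
  apply: eq_bigr => -[j i] _ /=; congr (_ / _).
  have -> : sin ((absd j i)%:R * th) * sin ((absd j i)%:R * a) =
    sin ((2 * j%:R - 2 * i%:R + 1) * th) * sin ((2 * j%:R - 2 * i%:R + 1) * a).
    have [ij|ij] := leqP i j.
      have -> : (absd j i)%:R = 2 * j%:R - 2 * i%:R + 1 :> R.
        have -> : absd j i = (2 * j + 1 - 2 * i)%N by rewrite /absd; lia.
        by rewrite natrB ?natrD ?natrM; [ring|lia].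
      by [].
    have -> : 2 * j%:R - 2 * i%:R + 1 = - (absd j i)%:R :> R.
      have -> : absd j i = (2 * i - (2 * j + 1))%N by rewrite /absd; lia.
      by rewrite natrB ?natrD ?natrM; [ring|lia].
    by rewrite !mulNr !sinN mulrNN.
  by rewrite mulrBr mulrDr cosB cosD; ring.
rewrite (partition_big (fun u : 'I_M * 'I_M => Ordinal (kap u.1 u.2)) xpredT)//=.
apply: eq_bigr => k _.
rewrite (eq_bigr (fun=> 2 * (sin (k%:R * th) * sin (k%:R * a)) / M%:R ^+ 2)); last first.
  by move=> u /eqP <-.
rewrite sumr_const /kernel_coef -[LHS]mulr_natr.
have -> : #|[pred u : 'I_M * 'I_M | Ordinal (kap u.1 u.2) == k]| = absd_count M k.
  by apply: eq_card => u; rewrite !inE -val_eqE.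
by ring.
Qed.

End OddKernel.

(** * Sums over bad cells and their clustering *)

Section BlockSums.
Context {R : realType}.

Lemma sum_inv_sqr (n : nat) : \sum_(e < n) (e.+1%:R ^+ 2)^-1 <= 2 :> R.
Proof.
have H m : \sum_(e < m.+1) (e.+1%:R ^+ 2)^-1 <= 2 - m.+1%:R^-1 :> R.
  elim: m => [|m IH]; first by rewrite big_ord1 expr1n invr1; lra.
  rewrite big_ord_recr /=; apply: le_trans (lerD IH (lexx _)) _.
  have m0 : 0 < m.+1%:R :> R by [].
  have -> : m.+2%:R = m.+1%:R + 1 :> R by rewrite -[m.+2%:R]natr1.
  set x := m.+1%:R in m0 *.
  have -> : 2 - x^-1 + ((x + 1) ^+ 2)^-1 =
      2 - (x + 1)^-1 - (x * (x + 1) ^+ 2)^-1 by field; rewrite !gt_eqF//; lra.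
  by rewrite lerBlDr lerDl invr_ge0 mulr_ge0 ?sqr_ge0 ?ltW.
case: n => [|n]; first by rewrite big_ord0.
by apply: le_trans (H n) _; rewrite lerBlDr lerDl invr_ge0.
Qed.

Definition ndist (i j : nat) : nat := ((i - j) + (j - i))%N.

Lemma sum_ndist_le (F : nat -> R) (T i : nat) : (i < T)%N -> (forall e, 0 <= F e) ->
  \sum_(j < T) F (ndist i j) <= 2 * \sum_(e < T.+1) F e.
Proof.
move=> iT F0; rewrite -(big_mkord xpredT (fun j => F (ndist i j))) (big_cat_nat (n := i))//=; last exact: ltnW.
rewrite mulr2n mulrDl mul1r; apply: lerD.
  have -> : \sum_(0 <= j < i) F (ndist i j) = \sum_(1 <= j < i.+1) F j.
    rewrite big_nat_rev add0n big_add1; apply: eq_big_nat => j /andP[_ ji].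
    by congr F; rewrite /ndist; lia.
  rewrite -(big_mkord xpredT F) [leRHS](big_cat_nat (n := 1))//=.
  rewrite [X in _ <= _ + X](big_cat_nat (n := i.+1))//=; last exact: ltnW.
  by rewrite addrCA lerDl addr_ge0 ?sumr_ge0.
have -> : \sum_(i <= j < T) F (ndist i j) = \sum_(0 <= j < T - i) F j.
  transitivity (\sum_(0 + i <= j < T) F (ndist i j)); first by rewrite add0n.
  rewrite big_addn; apply: eq_big_nat => j _; congr F; rewrite /ndist; lia.
rewrite -(big_mkord xpredT F) [leRHS](big_cat_nat (n := (T - i)%N))//=; last by lia.
by rewrite lerDl sumr_ge0.
Qed.

(** There are at most 8 bad cells per block and two blocks per distance. Distances 0 and 1
    contribute at most [2 * 2 * 8 * N], and [sum_inv_sqr] bounds the rest by [2 * 8 * 2 * Q]. *)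
Lemma block_sum_le (T w i : nat) (bad : pred nat) (f : nat -> R) (N Q : R) :
  (i < T)%N -> 0 <= N -> 0 <= Q ->
  (forall j, #|[set c : 'I_(T * w) | bad c & (c %/ w == j)%N]| <= 8)%N ->
  (forall c, (c < T * w)%N -> bad c -> (ndist i (c %/ w) <= 1)%N -> f c <= N) ->
  (forall c, (c < T * w)%N -> bad c -> (1 < ndist i (c %/ w))%N ->
    f c <= Q / (ndist i (c %/ w)).-1%:R ^+ 2) ->
  \sum_(c < T * w | bad c) f c <= 32 * N + 32 * Q.
Proof.
move=> iT N0 Q0 card8 near far.
have blk (c : 'I_(T * w)) : (c %/ w < T)%N by rewrite ltn_divLR ?ltn_ord//; case: (w) c => // -[]; rewrite muln0.
pose F e : R := if (e <= 1)%N then 8 * N else 8 * (Q / e.-1%:R ^+ 2).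
have F0 e : 0 <= F e.
  by rewrite /F; case: ifP => _; rewrite !mulr_ge0 ?invr_ge0 ?sqr_ge0.
apply: (@le_trans _ _ (\sum_(j < T) F (ndist i j))).
  rewrite (partition_big (fun c => Ordinal (blk c)) xpredT)//=.
  apply: ler_sum => j _.
  have card_le (x : R) : 0 <= x -> \sum_(c < T * w | bad c && (Ordinal (blk c) == j)) x <= 8 * x.
    move=> x0; rewrite sumr_const -[leLHS]mulr_natl ler_wpM2r// ler_nat.
    apply: leq_trans (card8 j); apply: eq_leq.
    by apply: eq_card => c; rewrite !inE.
  have cj (c : 'I_(T * w)) : Ordinal (blk c) == j -> (c %/ w)%N = j by move=> /eqP <-.
  rewrite /F; case: ifP => e1.
    apply: le_trans (card_le _ N0); apply: ler_sum => c /andP[bc /cj E].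
    by apply: near; rewrite ?E.
  have q0 : 0 <= Q / (ndist i j).-1%:R ^+ 2 by rewrite mulr_ge0 ?invr_ge0 ?sqr_ge0.
  apply: le_trans (card_le _ q0); apply: ler_sum => c /andP[bc /cj E].
  by rewrite -E; apply: far; rewrite // E ltnNge e1.
apply: le_trans (sum_ndist_le iT F0) _.
case: T iT {blk near far card8} => // T _; rewrite !big_ord_recl /F /=.
have -> : \sum_(e < T) (if (bump 0 (bump 0 e) <= 1)%N then 8 * N
    else 8 * (Q / (bump 0 (bump 0 e)).-1%:R ^+ 2)) = 8 * Q * \sum_(e < T) (e.+1%:R ^+ 2)^-1.
  by rewrite mulr_sumr; apply: eq_bigr => e _; rewrite /bump /= mulrA.
have := ler_wpM2l (_ : 0 <= 8 * Q) (sum_inv_sqr T).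
by rewrite mulr_ge0// => /(_ isT); lra.
Qed.

End BlockSums.

(* Every block of [16 b] cells contains [b] consecutive cells free of bad ones; cutting in the
   middle of such gaps groups the bad cells into clusters that respect distances below [b]. *)
Lemma clusters (T b : nat) (bad : pred nat) : (0 < b)%N ->
  (forall j, #|[set c : 'I_(T * (16 * b)) | bad c & (c %/ (16 * b) == j)%N]| <= 8)%N ->
  exists cl : nat -> nat,
    [/\ forall c, (c < T * (16 * b))%N -> (cl c <= T)%N,
        forall j, (#|[set c : 'I_(T * (16 * b)) | bad c & cl c == j]| <= 16)%N &
        forall c d, (c < T * (16 * b))%N -> (d < T * (16 * b))%N -> bad c -> bad d ->
          (ndist c d < b)%N -> cl c = cl d].
Proof.
move=> b0 card8; set H := (T * (16 * b))%N.
pose blk j := [set c : 'I_H | bad c & (c %/ (16 * b) == j)%N].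
(* Each block is cut into 16 sub-blocks of length [b]; 8 bad cells cannot meet all of them, so [m j]
   names a free one. *)
pose used j : {set 'I_16} := [set inord ((c %/ b) %% 16)%N | c : 'I_H in blk j].
pose m j : 'I_16 := odflt ord0 [pick x | x \notin used j].
have mP j : m j \notin used j.
  rewrite /m; case: pickP => [x //|/= none].
  have : (16 <= #|used j|)%N.
    rewrite -[X in (X <= _)%N](card_ord 16); apply/subset_leq_card/fintype.subsetP => x _.
    by have /negbFE := none x.
  by move=> /leq_trans/(_ (leq_imset_card _ _))/leq_trans/(_ (card8 j)).
have free c : (c < H)%N -> bad c -> ((c %/ b) %% 16 != m (c %/ b %/ 16))%N.
  move=> cH bc; apply/eqP => E; have /negP := mP (c %/ b %/ 16)%N; apply.
  apply/imsetP; exists (Ordinal cH); rewrite ?inE /= ?bc -?divnMA ?[(b * 16)%N]mulnC ?eqxx//.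
  by apply/val_inj; rewrite /= inordK ?ltn_pmod//= E mulnC divnMA.
(* A cluster is the part of one block after its free sub-block together with the part of the next
   block up to its own; this gives [T + 1] clusters with at most [8 + 8] bad cells each. *)
pose cl c := (c %/ b %/ 16 + (m (c %/ b %/ 16) < (c %/ b) %% 16))%N.
exists cl; split.
- move=> c cH; have : (c %/ b %/ 16 < T)%N.
    by rewrite -divnMA ltn_divLR ?muln_gt0 ?b0// [(b * 16)%N]mulnC.
  by move=> cT; rewrite /cl; case: (m _ < _)%N => /=; lia.
- move=> j; apply: (@leq_trans (#|blk j| + #|blk j.-1|)%N); last first.
    by rewrite (leq_add (card8 j) (card8 j.-1)).
  apply: leq_trans (leq_card_setU _ _); apply/subset_leq_card/fintype.subsetP => c.
  rewrite !inE /cl -divnMA [(b * 16)%N]mulnC => /andP[-> /eqP <-] /=.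
  by case: (m _ < _)%N; rewrite ?addn0 ?eqxx// addn1 /= eqxx orbT.
- move=> c d cH dH bc bd; wlog cd : c d cH dH bc bd / (c <= d)%N => [wl|].
    have [/wl|/ltnW/wl h] := leqP c d; first exact.
    by rewrite /ndist addnC => /h ->.
  move=> near; have := free c cH bc; have := free d dH bd; rewrite /cl.
  have h1 : (c %/ b <= d %/ b)%N by exact: leq_div2r.
  have h2 : (d %/ b <= (c %/ b).+1)%N.
    rewrite -ltnS ltn_divLR// !mulSn; have := ltn_ceil c b0; rewrite mulSn.
    by move: near; rewrite /ndist; lia.
  (* Cells at distance below [b] lie in the same or in adjacent sub-blocks; a change of [cl] between
     adjacent ones would put a bad cell into a free sub-block. *)
  have [->//|ne] := eqVneq (c %/ b)%N (d %/ b)%N.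
  have -> : (d %/ b = (c %/ b).+1)%N by lia.
  set v := (c %/ b)%N.
  have := divn_eq v 16; have := ltn_pmod v (isT : 0 < 16)%N.
  have := ltn_ord (m (v %/ 16)%N).
  have [vlt|vge] := ltnP (v %% 16).+1 16.
    have -> : (v.+1 %/ 16 = v %/ 16)%N by lia.
    have -> : (v.+1 %% 16 = (v %% 16).+1)%N by lia.
    by lia.
  have -> : (v.+1 %/ 16 = (v %/ 16).+1)%N by lia.
  have -> : (v.+1 %% 16 = 0)%N by lia.
  by lia.
Qed.

(** * Decay of the bumps and the choice of their signs *)

Section SineConstruction.
Context {R : realType}.
Implicit Types (th a : R).

(** Lets the decay bound for a bump at [a] serve its mirror image at [- a] as well. *)
Lemma abs_sinB_le th a : 0 <= th <= pi / 2 -> 0 <= a <= pi / 2 ->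
  `|sin (th - a)| <= sin (th + a).
Proof.
move=> t1 a1; rewrite sinB sinD.
have sc (x : R) : 0 <= x <= pi / 2 -> 0 <= sin x /\ 0 <= cos x.
  move=> /andP[x0 x1]; have := @pi_ge0 R => p0.
  by split; [apply: sin_ge0_pi|apply: cos_ge0_pihalf]; lra.
have [s1 c1] := sc _ t1; have [s2 c2] := sc _ a1.
have := mulr_ge0 s1 c2; have := mulr_ge0 c1 s2.
by rewrite ler_norml; lra.
Qed.

Lemma abs_sinE (x : R) : `|x| <= pi / 2 -> `|sin x| = sin `|x|.
Proof.
move=> x2; have : 0 <= sin `|x|.
  by apply: sin_ge0_pi; rewrite normr_ge0; have := @pi_ge0 R; lra.
have [x0|x0] := leP 0 x; first by rewrite (ger0_norm x0) => s0; rewrite ger0_norm.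
by rewrite (ltr0_norm x0) sinN => s0; rewrite ler0_norm//; lra.
Qed.

Lemma kernel_le_of_sin (M : nat) (x q : R) : (0 < M)%N -> 0 < q ->
  q <= M%:R * `|sin x| -> `|odd_kernel M x| <= (q ^+ 2)^-1.
Proof.
move=> M0 q0 qs; have := odd_kernel_sin x M0.
have -> : (M%:R * sin x) ^+ 2 = (M%:R * `|sin x|) ^+ 2.
  by rewrite !exprMn real_normK ?num_real.
move=> kM; rewrite -[leRHS]mul1r ler_pdivlMr ?exprn_gt0//; apply: le_trans kM.
by rewrite ler_wpM2l// lerXn2r ?nnegrE ?(ltW q0)// (le_trans (ltW q0)).
Qed.

(** [16 * M] cells of this width fill the quarter circle, and [M] times the width is
    [pi / 32 <= 1 / 8], the range of [odd_kernel_ge_half]. *)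
Definition cell_width (M : nat) : R := pi / (32 * M%:R).

Section Cells.
Variables (M T b : nat).
Hypotheses (T0 : (0 < T)%N) (b0 : (2048 <= b)%N) (MTb : M = (T * b)%N).
Let H := (T * (16 * b))%N.
Let h := cell_width M.

Let M0 : (0 < M)%N. Proof. by rewrite MTb muln_gt0 T0; lia. Qed.
Let MR : 0 < M%:R :> R. Proof. by rewrite ltr0n. Qed.
Let HE : H%:R * h = pi / 2 :> R.
Proof. by rewrite /H /h /cell_width MTb !natrM; field; rewrite !gt_eqF ?ltr0n//; lia. Qed.
Let Mh : 1 / 16 <= M%:R * h <= 1 / 8.
Proof.
have -> : M%:R * h = pi / 32 by rewrite /h /cell_width; field; rewrite gt_eqF.
by have := @pi_ge2 R; have := @pihalf_02 R => /andP[_ ?]; lra.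
Qed.
Let h0 : 0 < h. Proof. by rewrite /h divr_gt0 ?pi_gt0 ?mulr_gt0. Qed.

Lemma cell_pos (c : nat) : (c <= H)%N -> 0 <= c%:R * h <= pi / 2.
Proof.
move=> cH; rewrite mulr_ge0 ?(ltW h0)//= -HE ler_wpM2r ?(ltW h0)//.
by rewrite ler_nat.
Qed.

Lemma cell_point (d : nat) th : (d < H)%N -> d%:R * h <= th <= d.+1%:R * h -> 0 <= th <= pi / 2.
Proof.
move=> dH /andP[t0 t1]; have /andP[d0 _] := cell_pos (ltnW dH).
by rewrite (le_trans d0 t0) (le_trans t1)//; have /andP[] := cell_pos dH.
Qed.

Let cell_dist (c d : nat) th : d%:R * h <= th <= d.+1%:R * h ->
  (ndist d c)%:R * h <= `|th - c%:R * h| + h.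
Proof.
move=> /andP[]; rewrite -[d.+1%:R]natr1 mulrDl mul1r => t0 t1.
have [cd|dc] := leqP c d.
  have -> : (ndist d c)%:R = d%:R - c%:R :> R.
    by rewrite -natrB//; congr _%:R; rewrite /ndist; lia.
  have := ler_norm (th - c%:R * h); have := h0; lra.
have -> : (ndist d c)%:R = c%:R - d%:R :> R.
  by rewrite -natrB; [congr _%:R; rewrite /ndist; lia|exact: ltnW].
have := ler_norm (- (th - c%:R * h)); rewrite normrN; lra.
Qed.

(** Write [n] for the cell distance. The point is at least [n * h / 2] away from the node, the sine
    is at least a third of that, and [M * h >= 1 / 16]; so [M] times the sine is at least [n / 96],
    and [9216 = 96 ^ 2]. *)
Lemma cell_far (c d : nat) th : (c < H)%N -> (d < H)%N ->
  d%:R * h <= th <= d.+1%:R * h -> (1 < ndist d c)%N ->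
  `|odd_kernel M (th - c%:R * h)| <= 9216 / (ndist d c)%:R ^+ 2 /\
  `|odd_kernel M (th + c%:R * h)| <= 9216 / (ndist d c)%:R ^+ 2.
Proof.
move=> cH dH td e2; set n := ndist d c in e2 *.
have n2 : 2 <= n%:R :> R by rewrite ler_nat.
have t := cell_point dH td; have a := cell_pos (ltnW cH).
have d1 : n%:R * h / 2 <= `|th - c%:R * h|.
  by have := cell_dist c td; rewrite -/n; have := ler_wpM2r (ltW h0) n2; lra.
have sg : n%:R / 96 <= M%:R * `|sin (th - c%:R * h)|.
  have le_pi2 : `|th - c%:R * h| <= pi / 2 by rewrite ler_norml; lra.
  rewrite (abs_sinE le_pi2).
  have : `|th - c%:R * h| / 3 <= sin `|th - c%:R * h|.
    by apply: sin_ge_third; have := @pihalf_02 R; rewrite normr_ge0 /=; lra.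
  move=> s3; have : M%:R * (n%:R * h / 6) <= M%:R * sin `|th - c%:R * h|.
    by rewrite ler_wpM2l// (le_trans _ s3)//; lra.
  apply: le_trans; have -> : M%:R * (n%:R * h / 6) = M%:R * h * (n%:R / 6) by ring.
  by have /andP[m1 _] := Mh; nra.
have q0 : 0 < n%:R / 96 :> R by lra.
have -> : 9216 / n%:R ^+ 2 = ((n%:R / 96) ^+ 2)^-1 :> R by field; lra.
split; apply: kernel_le_of_sin => //.
apply: le_trans sg _; rewrite ler_wpM2l//; apply: le_trans (ler_norm _).
exact: abs_sinB_le.
Qed.

(** A node [b'] cells away from both ends keeps [th + c * h] at least [b' * h] away from 0 and [pi],
    where the kernel peaks. Here [2304 = 48 ^ 2] with [48 = 16 * 3]. *)
Lemma cell_reflected (c b' : nat) th : (0 < b')%N -> (b' <= c)%N -> (c + b' <= H)%N ->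
  0 <= th <= pi / 2 -> `|odd_kernel M (th + c%:R * h)| <= 2304 / b'%:R ^+ 2.
Proof.
move=> b'0 bc cb t.
have bR : 0 < b'%:R :> R by rewrite ltr0n.
have -> : 2304 / b'%:R ^+ 2 = ((b'%:R / 48) ^+ 2)^-1 :> R by field; rewrite gt_eqF.
apply: kernel_le_of_sin => //; first by rewrite divr_gt0.
have key (x : R) : b'%:R * h <= x <= pi / 2 -> b'%:R / 48 <= M%:R * sin x.
  move=> /andP[x1 x2]; have := @pihalf_02 R => /andP[p0 p2].
  have x0 : 0 <= x by apply: le_trans x1; rewrite mulr_ge0 ?(ltW h0).
  have s3 : x / 3 <= sin x by apply: sin_ge_third; lra.
  have : M%:R * (b'%:R * h / 3) <= M%:R * sin x by rewrite ler_wpM2l//; lra.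
  apply: le_trans; have -> : M%:R * (b'%:R * h / 3) = M%:R * h * (b'%:R / 3) by ring.
  by have /andP[m1 _] := Mh; nra.
have c1 : b'%:R * h <= c%:R * h by rewrite ler_wpM2r ?(ltW h0)// ler_nat.
have c2 : c%:R * h + b'%:R * h <= pi / 2.
  by rewrite -mulrDl -HE ler_wpM2r ?(ltW h0)// -natrD ler_nat.
move: t => /andP[t0 t1].
have [x2|/ltW x2] := leP (th + c%:R * h) (pi / 2).
  have /key : b'%:R * h <= th + c%:R * h <= pi / 2 by apply/andP; split=> //; lra.
  by move=> /le_trans; apply; rewrite ler_wpM2l// ler_norm.
have -> : sin (th + c%:R * h) = sin (pi - (th + c%:R * h)).
  by rewrite sinB sinpi cospi; ring.
have /key : b'%:R * h <= pi - (th + c%:R * h) <= pi / 2 by apply/andP; split; lra.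
by move=> /le_trans; apply; rewrite ler_wpM2l// ler_norm.
Qed.

End Cells.

End SineConstruction.

Lemma ndist_div (w c d : nat) : (0 < w)%N ->
  ((ndist (d %/ w) (c %/ w)).-1 * w <= ndist d c)%N.
Proof.
move=> w0; have := divn_eq c w; have := divn_eq d w.
have := ltn_pmod c w0; have := ltn_pmod d w0.
set p := (c %/ w)%N; set q := (d %/ w)%N; set r := (c %% w)%N; set s := (d %% w)%N.
move=> sw rw dE cE; rewrite {2}/ndist dE cE.
have [pq|qp|->] := ltngtP p q; last by rewrite /ndist subnn.
  have -> : (ndist q p).-1 = (q - p - 1)%N by rewrite /ndist; lia.
  have -> : (q = p + 1 + (q - p - 1))%N by lia.
  set e := (q - p - 1)%N; have -> : (p + 1 + e - p - 1 = e)%N by lia.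
  by rewrite !mulnDl; lia.
have -> : (ndist q p).-1 = (p - q - 1)%N by rewrite /ndist; lia.
have -> : (p = q + 1 + (p - q - 1))%N by lia.
set e := (p - q - 1)%N; have -> : (q + 1 + e - q - 1 = e)%N by lia.
by rewrite !mulnDl; lia.
Qed.

Section SineConstruction.
Context {R : realType}.

(* The sines of frequency below [2 M] resolve the cell width, the clusters of bad cells carry
   one sign each, and [D] is the discrepancy bound for choosing these signs. *)
Lemma sine_construction (M T b : nat) (bad : pred nat) (A D : R)
    (H := (T * (16 * b))%N) (h : R := cell_width M) :
  (0 < T)%N -> (2048 <= b)%N -> M = (T * b)%N ->
  (forall j, #|[set c : 'I_H | bad c & (c %/ (16 * b) == j)%N]| <= 8)%N ->
  (forall c, (c < H)%N -> bad c -> (b <= c)%N /\ (c + b <= H)%N) ->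
  0 < A -> 0 < D -> (2 * M)%:R * T.+1%:R <= D ^+ 4 -> 32 * 1000 * A * D <= M%:R ->
  exists x : nat -> R,
    [/\ forall k, `|x k| <= 1, forall k, ~~ odd k -> x k = 0 &
    forall d th, (d < H)%N -> d%:R * h <= th <= d.+1%:R * h ->
      let s := \sum_(k < 2 * M) x k * sin (k%:R * th) in
      `|s| <= 100 * A /\ (bad d -> A / 4 <= `|s|)].
Proof.
move=> T0 b2 MTb card8 edge A0 D0 hD hA.
have b0 : (0 < b)%N by lia.
have w0 : (0 < 16 * b)%N by lia.
have M0 : (0 < M)%N by rewrite MTb muln_gt0 T0.
have MR : 0 < M%:R :> R by rewrite ltr0n.
have [cl [clT cl16 clE]] := clusters b0 card8.
(* The contribution of cluster [i] to the sine coefficient at frequency [k], divided by the bound 16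
   on the cluster size so that entries are at most 1. *)
pose a (k : 'I_(2 * M)) (i : 'I_T.+1) : R :=
  (\sum_(c < H | bad c && (cl c == i)) sin (k%:R * (c%:R * h))) / 16.
have a1 k i : `|a k i| <= 1.
  rewrite normrM normfV [`|16|]ger0_norm// ler_pdivrMr// mul1r.
  apply: le_trans (ler_norm_sum _ _ _) _.
  apply: (@le_trans _ _ (\sum_(c < H | bad c && (cl c == i)) 1)).
    by apply: ler_sum => c _; exact: sin_max.
  rewrite sumr_const ler_nat; apply: leq_trans (cl16 i); apply: eq_leq.
  by apply: eq_card => c; rewrite !inE.
have [||e eP] := @discrepancy R 'I_(2 * M) 'I_T.+1 a setT D a1 _ D0.
- by rewrite cardsT !card_ord MTb; nia.
- by rewrite cardsT !card_ord.
pose al (c : nat) : R := (-1) ^+ e (inord (cl c)).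
pose V (k : nat) : R := \sum_(c < H | bad c) al c * sin (k%:R * (c%:R * h)).
have Vle k : (k < 2 * M)%N -> `|V k| <= 8 * 1000 * D.
  move=> kM; have := eP (Ordinal kM).
  have -> : signed_sum (a (Ordinal kM)) setT e = V k / 16.
    have clB (c : 'I_H) : (cl c < T.+1)%N by rewrite ltnS clT.
    rewrite /signed_sum /V (partition_big (fun c => Ordinal (clB c)) xpredT)//= mulr_suml.
    apply: eq_big => i; first by rewrite inE.
    move=> _; rewrite /a mulrAC; congr (_ / _); rewrite mulr_suml.
    apply: eq_big => c; first by rewrite -val_eqE.
    move=> /andP[_ /eqP E]; rewrite mulrC /al; congr ((-1) ^+ e _ * _).
    by apply/val_inj; rewrite /= inordK -?E// ltnS clT.
  rewrite normrM normfV [`|16|]ger0_norm//; lra.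
(* These are the coefficients given by [odd_kernel_sub] for [A] times the signed bumps. They are at
   most [A * (4 / M) * (16 * 500 * D)], and the hypothesis on [A * D] makes this at most 1. *)
pose x k : R := if (k < 2 * M)%N then A * kernel_coef M k * V k else 0.
have sE th : \sum_(k < 2 * M) x k * sin (k%:R * th) =
    A * \sum_(c < H | bad c) al c *
      (odd_kernel M (th - c%:R * h) - odd_kernel M (th + c%:R * h)).
  transitivity (\sum_(k < 2 * M) \sum_(c < H | bad c)
      A * (al c * (kernel_coef M k * sin (k%:R * th) * sin (k%:R * (c%:R * h))))).
    apply: eq_bigr => k _; rewrite /x ltn_ord /V mulr_sumr mulr_suml.
    by apply: eq_bigr => c _; ring.
  rewrite exchange_big mulr_sumr; apply: eq_bigr => c _ /=.
  by rewrite odd_kernel_sub !mulr_sumr.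
have al1 c : `|al c| = 1 by rewrite /al normrX normrN1 expr1n.
have u0 : 0 < b%:R :> R by rewrite ltr0n.
pose u : R := (b%:R ^+ 2)^-1.
have ule : u <= 1 / 2048 * (1 / 2048).
  have -> : u = b%:R^-1 * b%:R^-1 by rewrite /u expr2 invfM.
  have h1 : b%:R^-1 <= 1 / 2048 :> R by rewrite div1r lef_pV2 ?posrE// ler_nat.
  by rewrite ler_pM// invr_ge0.
have up : 0 <= u by rewrite invr_ge0 exprn_ge0.
exists x; split.
- move=> k; rewrite /x; case: ifP => kM; last by rewrite normr0.
  have /andP[g0 g1] := @kernel_coef_le R M k M0.
  rewrite (normrM (A * _)) (normrM A) (gtr0_norm A0) (ger0_norm g0).
  apply: (@le_trans _ _ (A * (4 / M%:R) * (8 * 1000 * D))).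
    apply: ler_pM => //; first by rewrite mulr_ge0 // ltW.
      by rewrite ler_pM2l.
    exact: Vle.
  have -> : A * (4 / M%:R) * (8 * 1000 * D) = (4 * 8 * 1000) * A * D / M%:R by ring.
  by rewrite ler_pdivrMr// mul1r; lra.
- by move=> k ek; rewrite /x kernel_coef_even// mulr0 mul0r if_same.
move=> d th dH td s; rewrite {}/s sE.
(* The cell distance is at least [16 * b] times the block distance minus one, and
   [72 = 2 * 9216 / 16 ^ 2]. *)
have far c : (c < H)%N -> (1 < ndist (d %/ (16 * b)) (c %/ (16 * b)))%N ->
    `|odd_kernel M (th - c%:R * h)| + `|odd_kernel M (th + c%:R * h)| <=
    (72 * u) / (ndist (d %/ (16 * b)) (c %/ (16 * b))).-1%:R ^+ 2.
  move=> cH; have := ndist_div c d w0; set n := ndist (_ %/ _) _ => nd n1.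
  have e2 : (1 < ndist d c)%N by apply: leq_trans nd; apply: (@leq_mul 1 2); [rewrite -ltnS prednK// ltnW|rewrite (@leq_mul 2 1)].
  have [f1 f2] := cell_far T0 b2 MTb cH dH td e2.
  apply: le_trans (lerD f1 f2) _.
  have np : (0 < n.-1)%N by case: (n) n1 => [|[]].
  have n0 : 0 < n.-1%:R :> R by rewrite ltr0n.
  have np2 : 0 < (n.-1 * (16 * b))%:R :> R by rewrite ltr0n muln_gt0 np.
  have nd2 : (n.-1 * (16 * b))%:R <= (ndist d c)%:R :> R by rewrite ler_nat.
  have inv_le : ((ndist d c)%:R ^+ 2)^-1 <= ((n.-1 * (16 * b))%:R ^+ 2)^-1 :> R.
    rewrite lef_pV2 ?posrE ?exprn_gt0//; last exact: lt_le_trans nd2.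
    by rewrite lerXn2r ?nnegrE// ltW// (lt_le_trans np2).
  have -> : 72 * u / n.-1%:R ^+ 2 = (9216 + 9216) / (n.-1 * (16 * b))%:R ^+ 2 :> R.
    by rewrite /u !natrM; field; rewrite !gt_eqF.
  by rewrite -mulrDl; apply: ler_wpM2l inv_le; rewrite addr_ge0// ler0n.
have iT : (d %/ (16 * b) < T)%N by rewrite ltn_divLR.
have th0 : 0 <= th <= pi / 2 := cell_point T0 b2 MTb dH td.
have N1 y : `|odd_kernel M y| <= 1 :> R by exact: odd_kernel_le1.
split.
  rewrite normrM (gtr0_norm A0) mulrC ler_pM2r//.
  apply: le_trans (ler_norm_sum _ _ _) _.
  apply: (@le_trans _ _ (32 * 2 + 32 * (72 * u))); last by lra.
  apply: (@block_sum_le R T (16 * b) (d %/ (16 * b)) bad (fun c =>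
    `|al c * (odd_kernel M (th - c%:R * h) - odd_kernel M (th + c%:R * h))|)) => //.
  - by rewrite !mulr_ge0.
  - move=> c cH bc _; rewrite normrM al1 mul1r; apply: le_trans (ler_normB _ _) _.
    by have := N1 (th - c%:R * h); have := N1 (th + c%:R * h); lra.
  - move=> c cH bc n1; rewrite normrM al1 mul1r; apply: le_trans (ler_normB _ _) _.
    exact: far.
move=> bd; rewrite normrM (gtr0_norm A0) ler_wpM2l ?(ltW A0)//.
set S := \sum_(c < H | _) _.
apply: (@le_trans _ _ (al d * S)); last first.
  by apply: le_trans (ler_norm _) _; rewrite normrM al1 mul1r.
(* After multiplication by the sign of [d], direct bumps of the same cluster contribute
   nonnegatively; [f] collects what may be lost, namely mirror images and bumps of other clusters.
   For [b >= 2048] the loss stays below 1/4, while the bump at [d] gives 1/2. *)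
pose f (c : nat) : R := `|odd_kernel M (th + c%:R * h)| +
  (if cl c == cl d then 0 else `|odd_kernel M (th - c%:R * h)|).
have fsum : \sum_(c < H | bad c) f c <= 32 * (12 * 1000 * u) + 32 * (72 * u).
  apply: (@block_sum_le R T (16 * b) (d %/ (16 * b)) bad f) => //.
  - by rewrite !mulr_ge0.
  - by rewrite !mulr_ge0.
  - move=> c cH bc _; have [e1 e2] := edge c cH bc.
    have := cell_reflected T0 b2 MTb b0 e1 e2 th0; rewrite -/h -/u /f.
    case: eqP => [_|/eqP clne]; first by lra.
    have nb : (b <= ndist d c)%N.
      by rewrite leqNgt; apply: contraNN clne => near; apply/eqP/esym/clE.
    have n1 : (1 < ndist d c)%N by apply: leq_trans nb; exact: leq_trans b2.
    have [f1 _] := cell_far T0 b2 MTb cH dH td n1.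
    have : 9216 / (ndist d c)%:R ^+ 2 <= 9216 * u :> R.
      rewrite ler_wpM2l// lef_pV2 ?posrE ?exprn_gt0// ?ltr0n ?(leq_trans b0 nb)//.
      by rewrite lerXn2r ?nnegrE// ler_nat.
    by move: f1; rewrite -/h; lra.
  - move=> c cH bc n1; apply: le_trans (far c cH n1); rewrite /f addrC.
    by case: eqP => _; rewrite lerD2r.
have own : 1 / 2 <= odd_kernel M (th - d%:R * h).
  apply: odd_kernel_ge_half => //; have /andP[t1 t2] := td.
  have h0 : 0 < h by rewrite divr_gt0 ?pi_gt0// mulr_gt0.
  rewrite ger0_norm ?subr_ge0//; apply: (@le_trans _ _ (M%:R * h)).
    by rewrite ler_wpM2l//; move: t2; rewrite -[d.+1%:R]natr1 mulrDl; lra.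
  have -> : M%:R * h = pi / 32 by rewrite /h /cell_width; field; rewrite gt_eqF.
  by have := @pihalf_02 R => /andP[_ ?]; lra.
have nonneg c : (c < H)%N -> 0 <= odd_kernel M (th - c%:R * h).
  move=> cH; have := @cell_pos R _ _ _ T0 b2 MTb _ (ltnW cH); rewrite -/h => ch.
  apply/odd_kernel_ge0/cos_ge0_pihalf; have /andP[t1 t2] := th0; have /andP[c1 c2] := ch.
  by apply/andP; split; lra.
have : al d * S >= \sum_(c < H | bad c) (odd_kernel M (th - c%:R * h) * (c == d :> nat)%:R - f c).
  rewrite /S mulr_sumr; apply: ler_sum => c bc.
  have cH := ltn_ord c; have g0 := nonneg c cH.
  have r1 := ler_norm (odd_kernel M (th + c%:R * h)).
  have r2 := ler_norm (- odd_kernel M (th + c%:R * h)); rewrite normrN in r2.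
  have r3 := ler_norm (- odd_kernel M (th - c%:R * h)); rewrite normrN in r3.
  have r4 := ler_norm (odd_kernel M (th - c%:R * h)).
  have aa : al d * al c = (-1) ^+ (e (inord (cl d)) (+) e (inord (cl c))) by rewrite signr_addb.
  rewrite mulrA aa /f; have [clcd|clne] := eqVneq (cl c) (cl d).
    rewrite clcd addbb expr0 mul1r addr0; case: (nat_of_ord c == d); rewrite /= ?mulr1 ?mulr0; lra.
  have -> : (nat_of_ord c == d) = false by apply/negbTE; apply: contraNneq clne => ->.
  by case: (_ (+) _); rewrite /= ?expr1 ?expr0 ?mulN1r ?mul1r; lra.
apply: le_trans; rewrite sumrB.
have -> : \sum_(c < H | bad c) odd_kernel M (th - c%:R * h) * (c == d :> nat)%:R =
    odd_kernel M (th - d%:R * h).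
  rewrite (bigD1 (Ordinal dH))//= eqxx mulr1 big1 ?addr0// => c /andP[_ cd].
  by rewrite -val_eqE /= in cd; rewrite (negbTE cd) mulr0.
lra.
Qed.

End SineConstruction.

(** * Flat Littlewood polynomials *)

Section BadCells.
Context {R : realType}.

Definition bad_cell (t T M : nat) (e : R) (c : nat) : bool :=
  `[< exists2 th : R, c%:R * cell_width M <= th <= c.+1%:R * cell_width M &
        `|rs_cosine t T (2 * th)| <= e * Num.sqrt (2 ^+ t.+1) >].

Variables (t T b M : nat) (e : R).
Hypotheses (T0 : (0 < T)%N) (b0 : (0 < b)%N) (MTb : M = (T * b)%N) (e0 : 0 <= e).
Hypothesis small : (120 * b%:R) ^+ 5 * (4 * (e + 4 * 2 ^+ t * pi / T%:R)) <= 1.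
Let h : R := cell_width M.
Let S : R := Num.sqrt (2 ^+ t.+1).

Let TR : 0 < T%:R :> R. Proof. by rewrite ltr0n. Qed.
Let bR : 1 <= b%:R :> R. Proof. by rewrite ler1n. Qed.
Let hE : T%:R * h = pi / (32 * b%:R).
Proof.
by rewrite /h /cell_width MTb natrM; field; rewrite !gt_eqF// (lt_le_trans _ bR).
Qed.
Let h0 : 0 < h.
Proof. by rewrite divr_gt0 ?pi_gt0// mulr_gt0// ltr0n MTb muln_gt0 T0. Qed.

(** Distinct cells of one parity have a whole cell between them, so points chosen in them are a cell
    width apart; doubling the angle and scaling by [T] makes this [pi / (16 b) >= 1 / (8 b)], and
    makes a block a window of length [pi]. As [15 * 8 b = 120 b], five points would contradict
    [small] through [rs_cosine_five]. *)
Lemma bad_cells_parity (j : nat) (o : bool) :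
  (#|[set c : 'I_(T * (16 * b)) | [&& bad_cell t T M e c, (c %/ (16 * b) == j)%N & odd c == o]]|
    <= 4)%N.
Proof.
rewrite leqNgt; apply/negP; set B := [set c | _] => B5.
have badP (c : nat) : exists th : R, bad_cell t T M e c ->
    c%:R * h <= th <= c.+1%:R * h /\ `|rs_cosine t T (2 * th)| <= e * S.
  have [bc|nb] := boolP (bad_cell t T M e c); last by exists 0.
  by have /asboolP[th h1 h2] := bc; exists th.
pose th c := sval (cid (badP c)).
have thP c : bad_cell t T M e c ->
    c%:R * h <= th c <= c.+1%:R * h /\ `|rs_cosine t T (2 * th c)| <= e * S.
  exact: (svalP (cid (badP c))).
pose s := take 5 (enum B).
have ss : size s = 5%N by rewrite size_takel// -cardE.
have sB c : c \in s -> c \in B by move=> /mem_take; rewrite mem_enum.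
have us : uniq s by rewrite take_uniq ?enum_uniq.
have sg0 : 0 < (8 * b%:R)^-1 :> R by rewrite invr_gt0 mulr_gt0// (lt_le_trans _ bR).
have sg3 : (8 * b%:R)^-1 <= 3 :> R.
  by rewrite -[leRHS]invrK lef_pV2 ?posrE ?invr_gt0 ?mulr_gt0 ?(lt_le_trans _ bR)//; have := bR; lra.
have := @rs_cosine_five R t T (8 * b%:R)^-1 e [seq 2 * th c | c : 'I_(T * (16 * b)) <- s] T0.
rewrite sg0 sg3 size_map ss => /(_ isT e0 erefl).
have -> : 15 / (8 * b%:R)^-1 = 120 * b%:R :> R by rewrite invrK; ring.
suff H : (pairwise (fun x y => (8 * b%:R)^-1 <= T%:R * `|x - y| <= pi)
    [seq 2 * th c | c : 'I_(T * (16 * b)) <- s]).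
  move=> /(_ H) H2; move: small; rewrite leNgt H2// => x /mapP[c /sB].
  by rewrite inE => /andP[/thP[_ ?] _] ->.
rewrite pairwise_map; move: us; rewrite uniq_pairwise; apply: sub_in_pairwise.
move=> c d /= /sB + /sB + cd.
rewrite !inE => /and3P[bc /eqP cj /eqP co] /and3P[bd /eqP dj /eqP do'].
have w0 : (0 < 16 * b)%N by rewrite muln_gt0.
wlog lt : c d cd bc cj co bd dj do' / (c < d)%N => [wl|].
  have [/wl|ge] := ltnP c d; first exact.
  rewrite distrC; apply: wl => //; first by rewrite eq_sym.
  by rewrite ltn_neqAle ge andbT eq_sym.
have c2 : (c + 2 <= d)%N.
  have : odd c = odd d by rewrite co do'.
  by move: lt; rewrite leq_eqVlt => /predU1P[<-|]; [rewrite /=; case: (odd c)|rewrite addn2].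
have cw : (d.+1 <= c + 16 * b)%N.
  by apply: leq_trans (ltn_ceil d w0) _; rewrite dj -cj mulSn addnC leq_add2r leq_divM.
have [/andP[c3 c4] _] := thP c bc; have [/andP[d3 d4] _] := thP d bd.
have l1 : (c.+1%:R + 1) * h <= d%:R * h.
  by rewrite ler_wpM2r ?(ltW h0)// natr1 ler_nat -[c.+2]addn2.
have l2 : d.+1%:R * h <= (c%:R + 16 * b%:R) * h.
  by rewrite ler_wpM2r ?(ltW h0)// -natrM -natrD ler_nat.
rewrite mulrDl mul1r in l1; rewrite mulrDl in l2.
have -> : `|2 * th c - 2 * th d| = 2 * (th d - th c).
  by rewrite distrC ger0_norm; lra.
have e1 : T%:R * h <= T%:R * (th d - th c) by rewrite ler_wpM2l ?(ltW TR)//; lra.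
have e2 : T%:R * (th d - th c) <= 16 * b%:R * (T%:R * h).
  have : T%:R * (th d - th c) <= T%:R * (16 * b%:R * h) by rewrite ler_wpM2l ?(ltW TR)//; lra.
  by rewrite mulrCA.
rewrite hE in e1 e2; have b1 : 0 < b%:R :> R by apply: lt_le_trans bR.
apply/andP; split; rewrite mulrCA.
  have : (16 * b%:R)^-1 <= pi / (32 * b%:R) :> R.
    have -> : (16 * b%:R)^-1 = 2 / (32 * b%:R) :> R by field; rewrite gt_eqF.
    by rewrite ler_pM2r ?invr_gt0 ?mulr_gt0// pi_ge2.
  have -> : (8 * b%:R)^-1 = 2 * (16 * b%:R)^-1 :> R by field; rewrite gt_eqF.
  lra.
have -> : pi = 2 * (16 * b%:R * (pi / (32 * b%:R))) :> R by field; rewrite gt_eqF.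
lra.
exact: allss.
Qed.

Lemma bad_cells_block (j : nat) :
  (#|[set c : 'I_(T * (16 * b)) | bad_cell t T M e c & (c %/ (16 * b) == j)%N]| <= 8)%N.
Proof.
apply: leq_trans (leq_add (bad_cells_parity j true) (bad_cells_parity j false)).
apply: leq_trans (leq_card_setU _ _); apply/subset_leq_card/fintype.subsetP => c.
by rewrite !inE => /andP[-> ->] /=; case: (odd c).
Qed.

(** Near 0 the pair is close to [(S, 0)], near [pi] to [(0, S)]. The phases [T ph] and [2 T ph] are
    at most 1/2, so the cosine factor is at least 7/8; the drift of the pair costs at most
    [k / 4 * S], and [e + k <= 1 / 4]. *)
Lemma rs_cosine_edge (ph : R) : t = t./2.*2.+1 -> 
  0 <= ph <= pi / (16 * T%:R) ->
  e * S < `|rs_cosine t T ph| /\ e * S < `|rs_cosine t T (pi - ph)|.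
Proof.
move=> todd /andP[p0 p1].
have SE : S = 2 ^+ t./2.+1.
  by rewrite /S {1}todd -doubleS -muln2 exprM sqrtr_sqr ger0_norm // exprn_ge0.
have S0 : 0 < S by rewrite SE exprn_gt0.
have [P0 Q0 P1 Q1] := @rs_odd_values R t./2; rewrite -todd -SE in P0 Q0 P1 Q1.
pose k : R := 4 * 2 ^+ t * pi / T%:R.
have k0 : 0 <= k by rewrite divr_ge0 ?mulr_ge0 ?exprn_ge0 ?pi_ge0.
have ek : e + k <= 1 / 4.
  have b120 : 1 <= 120 * b%:R :> R by have := bR; lra.
  have b5 : 1 <= (120 * b%:R) ^+ 5 :> R by exact: exprn_ege1.
  move: small; rewrite -/k => h1.
  have : 1 * (4 * (e + k)) <= (120 * b%:R) ^+ 5 * (4 * (e + k)).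
    by rewrite ler_wpM2r// mulr_ge0// addr_ge0.
  lra.
have lip x y : `|x - y| <= ph ->
    normc (rsP t x - rsP t y) <= k / 8 * S /\ normc (rsQ t x - rsQ t y) <= k / 8 * S.
  move=> xy; have [h1 h2] := rs_lipschitz t x y.
  have : 2 * 2 ^+ t * S * `|x - y| <= k / 8 * S.
    have -> : k / 8 * S = 2 * 2 ^+ t * S * (pi / (4 * T%:R)).
      by rewrite /k; field; rewrite gt_eqF.
    rewrite ler_wpM2l ?mulr_ge0 ?exprn_ge0 ?(ltW S0)//.
    apply: le_trans xy _; apply: le_trans p1 _.
    by rewrite ler_wpM2l ?pi_ge0// lef_pV2 ?posrE ?mulr_gt0//; have := TR; lra.
  by move=> h3; split; [exact: le_trans h1 h3|exact: le_trans h2 h3].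
have ReD (u v : R[i]) : complex.Re (u + v) = complex.Re u + complex.Re v.
  by case: u; case: v.
have ReM (u : R[i]) (v : R) : complex.Re (u * v%:C) = complex.Re u * v.
  by case: u => u1 u2; simpc.
have Tph : T%:R * ph <= 1 / 4.
  have : T%:R * ph <= T%:R * (pi / (16 * T%:R)) by rewrite ler_wpM2l// ltW.
  have -> : T%:R * (pi / (16 * T%:R)) = pi / 16 :> R by field; rewrite gt_eqF.
  by have := @pihalf_02 R => /andP[_ ?]; lra.
have Tp0 : 0 <= T%:R * ph by rewrite mulr_ge0.
have Scos (x : R) : 0 <= x <= 1 / 2 -> 7 / 8 * S <= cos x * S.
  move=> /andP[x0 x1]; rewrite ler_wpM2r ?(ltW S0)//; apply: le_trans (cos_ge _); nra.
have close (u v p q p' q' : R[i]) : normc u = 1 -> normc v = 1 ->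
    normc (p - p') <= k / 8 * S -> normc (q - q') <= k / 8 * S ->
    complex.Re (u * p' + v * q') - k / 4 * S <= complex.Re (u * p + v * q).
  move=> nu nv n1 n2; have -> : u * p + v * q =
    (u * p' + v * q') + (u * (p - p') + v * (q - q')) by ring.
  rewrite [leRHS]ReD lerD2l lerNl; apply: le_trans (ler_norm _) _; rewrite normrN.
  apply: le_trans (Re_le_normc _) _; apply: le_trans (normcD _ _) _.
  by rewrite !normcM nu nv !mul1r; lra.
split; apply: lt_le_trans (ler_norm _); rewrite /rs_cosine.
  have d0 : `|ph - 0| <= ph by rewrite subr0 ger0_norm.
  have [l1 l2] := lip _ _ d0.
  apply: lt_le_trans (close _ _ _ _ _ _ (normc_cis _) (normc_cis _) l1 l2).
  rewrite P0 Q0 mulr0 addr0 ReM [complex.Re _]/=.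
  have := Scos (T%:R * ph); nra.
have d0 : `|pi - ph - pi| <= ph by rewrite addrC addKr normrN ger0_norm.
have [l1 l2] := lip _ _ d0.
apply: lt_le_trans (close _ _ _ _ _ _ (normc_cis _) (normc_cis _) l1 l2).
rewrite P1 Q1 mulr0 add0r ReM [complex.Re _]/=.
have -> : cos ((2 * T)%:R * (pi - ph)) = cos (2 * (T%:R * ph)).
  have -> : (2 * T)%:R * (pi - ph) = - (2 * (T%:R * ph)) + pi *+ 2 *+ T.
    by rewrite -mulrnA -[pi *+ _]mulr_natr !natrM; ring.
  by rewrite (periodicn (@cosD2pi R)) cosN.
have := Scos (2 * (T%:R * ph)); nra.
Qed.

(** In the doubled angle [b] cells measure [pi / (16 T)], the range of [rs_cosine_edge], and the end
    [th = pi / 2] becomes [pi]. *)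
Lemma bad_cells_edge (c : nat) : t = t./2.*2.+1 -> (c < T * (16 * b))%N ->
  bad_cell t T M e c -> (b <= c)%N /\ (c + b <= T * (16 * b))%N.
Proof.
move=> todd cH /asboolP[th /andP[t1 t2] small_th]; rewrite -/h in t1 t2.
have b1 : 0 < b%:R :> R by apply: lt_le_trans bR.
have bh : 2 * (b%:R * h) = pi / (16 * T%:R).
  by rewrite /h /cell_width MTb natrM; field; rewrite !gt_eqF.
have HhE : (T * (16 * b))%:R * h = pi / 2.
  by rewrite /h /cell_width MTb !natrM; field; rewrite !gt_eqF.
have th0 : 0 <= th by apply: le_trans t1; rewrite mulr_ge0 ?(ltW h0).
split; rewrite leqNgt; apply/negP => edge.
  have [] := @rs_cosine_edge (2 * th) todd; last by rewrite ltNge small_th.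
  rewrite -bh; apply/andP; split; first lra.
  have : c.+1%:R * h <= b%:R * h by rewrite ler_wpM2r ?(ltW h0)// ler_nat.
  lra.
have [] := @rs_cosine_edge (pi - 2 * th) todd; last first.
  by move=> _; rewrite opprB addrCA subrr addr0 ltNge small_th.
rewrite -bh.
have h1 : (T * (16 * b))%:R * h <= (c%:R + b%:R) * h.
  by rewrite ler_wpM2r ?(ltW h0)// -natrD ler_nat ltnW.
have h2 : c.+1%:R * h <= (T * (16 * b))%:R * h by rewrite ler_wpM2r ?(ltW h0)// ler_nat.
by rewrite HhE in h1 h2; rewrite [leRHS]mulrDl in h1; apply/andP; split; lra.
Qed.

End BadCells.

(** * Rounding the sine coefficients and building the polynomial *)

Section Assembly.
Context {R : realType}.
Implicit Types (x y th : R).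

Lemma Im_sum (I : Type) (r : seq I) (P : pred I) (F : I -> R[i]) :
  complex.Im (\sum_(i <- r | P i) F i) = \sum_(i <- r | P i) complex.Im (F i).
Proof. by elim/big_rec2: _ => // i _ z _ <-; case: z (F i) => [? ?] [? ?]. Qed.

(** Rows sample both sines and cosines at [2 (m + 1)] points, because [grid_sup_le] needs the
    modulus of the complex polynomial. With [4 (m + 1)] rows and [m + 1] columns,
    [D = sqrt (2 (m + 1))]; and [3003 = 3/2 * 2 * 1001]. *)
Lemma round_sines (m : nat) (x : nat -> R) (free : pred nat) : (forall k, `|x k| <= 1) ->
  exists e : nat -> bool, forall th,
    `|\sum_(k < m.+1 | free k) ((-1) ^+ e k - x k) * sin (k%:R * th)| <=
      3003 * Num.sqrt (2 * m.+1%:R).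
Proof.
move=> x1; set D := Num.sqrt _.
have m0 : 0 < m.+1%:R :> R by rewrite ltr0n.
have D0 : 0 < D by rewrite sqrtr_gt0 mulr_gt0.
pose G := (2 * m.+1)%N.
pose a (i : 'I_G * bool) (k : 'I_m.+1) : R := if free k then
  (if i.2 then cos (k%:R * grid G i.1) else sin (k%:R * grid G i.1)) else 0.
have a1 i k : `|a i k| <= 1.
  by rewrite /a; case: (free k); case: i.2; rewrite ?normr0 ?cos_max ?sin_max.
have [||e eP] := @linear_discrepancy R _ _ a D (fun k => x k) a1 _ D0 _ (fun k => x1 k).
- by rewrite card_prod card_bool !card_ord /G; lia.
- rewrite card_prod card_bool !card_ord /G.
  have -> : D ^+ 4 = (2 * m.+1%:R) ^+ 2 by rewrite -[2 * _]sqr_sqrtr -?exprM// mulr_ge0.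
  by rewrite -!natrM -natrX ler_nat; lia.
pose d k : R := if free k then (-1) ^+ e (inord k) - x k else 0.
exists (fun k => e (inord k)) => th.
have E (F : nat -> R) : \sum_(k < m.+1 | free k) ((-1) ^+ e (inord k) - x k) * F k =
    \sum_(k < m.+1) d k * F k.
  by rewrite big_mkcond; apply: eq_bigr => k _; rewrite /d; case: ifP; rewrite ?mul0r.
rewrite (E (fun k => sin (k%:R * th))).
pose p y : R[i] := \sum_(k < m.+1) (d k)%:C * cis (k%:R * y).
have Rep y : complex.Re (p y) = \sum_(k < m.+1) d k * cos (k%:R * y).
  by rewrite Re_sum; apply: eq_bigr => k _; rewrite /cis; simpc.
have Imp y : complex.Im (p y) = \sum_(k < m.+1) d k * sin (k%:R * y).
  by rewrite Im_sum; apply: eq_bigr => k _; rewrite /cis; simpc.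
have row (i : 'I_G * bool) : \sum_(k < m.+1) a i k * ((-1) ^+ e k - x k) =
    \sum_(k < m.+1) d k * (if i.2 then cos (k%:R * grid G i.1) else sin (k%:R * grid G i.1)).
  apply: eq_bigr => k _; rewrite /a /d inord_val; case: ifP => _; last by rewrite !mul0r.
  by rewrite mulrC.
have pG (j : 'I_G) : normc (p (grid G j)) <= 2002 * D.
  apply: le_trans (normc_le_ReIm _) _; rewrite Rep Imp.
  by have := eP (j, true); have := eP (j, false); rewrite !row /=; lra.
have := grid_sup_le (ltn0Sn m) pG th; rewrite -/(p th).
by have := Im_le_normc (p th); rewrite Imp; lra.
Qed.

Lemma cis_addN y : cis y + cis (- y) = (2 * cos y)%:C.
Proof. by rewrite cisN /cis; simpc; congr (_ +i* _); ring. Qed.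

Lemma cis_subN y : cis y - cis (- y) = (2 * sin y)%:C * 'i%C.
Proof. by rewrite cisN /cis; simpc; congr (_ +i* _); ring. Qed.

Definition half_sum (m : nat) (g : nat -> R) (F : R -> R) th : R :=
  \sum_(k < m.+1) g k * F (k%:R * th).

(* The coefficients [c] and [d] carry the cosine (self-reciprocal) and the sine
   (anti-reciprocal) part of the polynomial, divided by [z ^ m]. *)
Definition symm_poly (m : nat) (c d : nat -> R) : {poly R[i]} :=
  \poly_(i < m + m.+1) (if (i < m)%N then c (m - i)%N - d (m - i)%N
                        else c (i - m)%N + d (i - m)%N)%:C.

(** Frequencies [k] and [- k] carry [c + d] and [c - d], which pair up to a cosine and a sine term.
    The middle coefficient has no partner, so [d 0] is not doubled. *)
Lemma symm_poly_eval (m : nat) (c d : nat -> R) th : c 0%N = 0 ->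
  (symm_poly m c d).[cis th] = cis (m%:R * th) *
    ((d 0%N + 2 * half_sum m c cos th) +i* (2 * half_sum m d sin th)).
Proof.
move=> c0; rewrite /symm_poly horner_poly big_split_ord /= big_ord_recl /=.
rewrite addn0 ltnn subnn c0 add0r addrCA cisX.
have -> : \sum_(i < m) (if (i < m)%N then c (m - i)%N - d (m - i)%N else c (i - m)%N + d (i - m)%N)%:C *
    cis th ^+ i = \sum_(i < m) (c i.+1 - d i.+1)%:C * (cis (m%:R * th) * cis (- (i.+1%:R * th))).
  rewrite (reindex_inj rev_ord_inj) /=; apply: eq_bigr => i _.
  have im := ltn_ord i.
  have -> : (m - i.+1 < m)%N by lia.
  have -> : (m - (m - i.+1) = i.+1)%N by lia.
  by rewrite cisX -cisD natrB//; congr (_ * cis _); ring.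
have -> : \sum_(i < m) (if (m + bump 0 i < m)%N then c (m - (m + bump 0 i))%N - d (m - (m + bump 0 i))%N
    else c (m + bump 0 i - m)%N + d (m + bump 0 i - m)%N)%:C * cis th ^+ (m + bump 0 i) =
    \sum_(i < m) (c i.+1 + d i.+1)%:C * (cis (m%:R * th) * cis (i.+1%:R * th)).
  apply: eq_bigr => i _; rewrite /bump /= add1n ltnNge leq_addr /= addKn.
  by rewrite cisX -cisD natrD; congr (_ * cis _); ring.
have half g F : g 0%N * F 0 = 0 -> half_sum m g F th = \sum_(i < m) g i.+1 * F (i.+1%:R * th).
  by move=> g0; rewrite /half_sum big_ord_recl mul0r g0 add0r.
rewrite !half ?c0 ?mul0r ?sin0 ?mulr0// -big_split /=.
have -> : (d 0%N + 2 * \sum_(i < m) c i.+1 * cos (i.+1%:R * th)) +i*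
      (2 * \sum_(i < m) d i.+1 * sin (i.+1%:R * th)) =
    (d 0%N)%:C + \sum_(i < m) ((c i.+1)%:C * (2 * cos (i.+1%:R * th))%:C +
       (d i.+1)%:C * ((2 * sin (i.+1%:R * th))%:C * 'i%C)) :> R[i].
  transitivity ((d 0%N + 2 * \sum_(i < m) c i.+1 * cos (i.+1%:R * th))%:C +
    (2 * \sum_(i < m) d i.+1 * sin (i.+1%:R * th))%:C * 'i%C); first by simpc.
  rewrite !mulr_sumr rmorphD -addrA !rmorph_sum mulr_suml -big_split /=; congr (_ + _).
  by apply: eq_bigr => i _; rewrite [X in _ = _ + X]mulrA -!rmorphM; congr (_%:C + _%:C * _); ring.
rewrite mulrDr mulr_sumr mulrC; congr (_ + _); apply: eq_bigr => i _.
by rewrite -cis_addN -cis_subN rmorphB rmorphD /=; ring.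
Qed.

Lemma symm_poly_littlewood (m : nat) (c d : nat -> R) :
  (forall k, (c k = 0 /\ (d k = 1 \/ d k = -1)) \/ ((c k = 1 \/ c k = -1) /\ d k = 0)) ->
  littlewood (m + m) (symm_poly m c d).
Proof.
move=> cd.
have sgD k : c k + d k = 1 \/ c k + d k = -1.
  by case: (cd k) => [[-> [->|->]]|[[->|->] ->]]; rewrite ?add0r ?addr0; [left|right|left|right].
have sgB k : c k - d k = 1 \/ c k - d k = -1.
  by case: (cd k) => [[-> [->|->]]|[[->|->] ->]]; rewrite ?add0r ?subr0 ?opprK; [right|left|left|right].
have sgC (x : R) : x = 1 \/ x = -1 -> x%:C = 1 \/ x%:C = -1 :> R[i].
  by move=> [->|->]; [left|right; rewrite rmorphN].
have sg k : let x := if (k < m)%N then c (m - k)%N - d (m - k)%N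
    else c (k - m)%N + d (k - m)%N in x%:C = 1 \/ x%:C = -1 :> R[i].
  by apply: sgC; case: ifP => _; [exact: sgB|exact: sgD].
split; last first.
  by move=> k km; rewrite coef_poly addnS ltnS km; exact: sg.
rewrite /symm_poly addnS size_poly_eq//=.
by case: (sg (m + m)%N) => ->; rewrite ?oppr_eq0 oner_eq0.
Qed.

Definition rs_coef (t T k : nat) : R :=
  \sum_(j < 2 ^ t | k == (2 * (T + j))%N) (rs t).1 j +
  \sum_(j < 2 ^ t | k == (2 * (2 * T + j))%N) (rs t).2 j.

Lemma rs_coef_sum (t T m : nat) th : (2 * (2 * T + 2 ^ t) <= m)%N ->
  half_sum m (rs_coef t T) cos th = rs_cosine t T (2 * th).
Proof.
move=> Tm.
have one (N : nat) (c : nat -> R) : (2 * (N + 2 ^ t) <= m)%N ->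
    \sum_(k < m.+1) (\sum_(j < 2 ^ t | k == (2 * (N + j))%N :> nat) c j) * cos (k%:R * th) =
    complex.Re (cis (N%:R * (2 * th)) * trigp c (2 ^ t) (2 * th)).
  move=> Nm; rewrite /trigp mulr_sumr Re_sum.
  transitivity (\sum_(k < m.+1) \sum_(j < 2 ^ t)
      (if k == (2 * (N + j))%N :> nat then c j * cos (k%:R * th) else 0)).
    apply: eq_bigr => k _; rewrite mulr_suml big_mkcond; apply: eq_bigr => j _.
    by case: ifP.
  rewrite exchange_big; apply: eq_bigr => j _ /=.
  have jm : (2 * (N + j) < m.+1)%N by have := ltn_ord j; lia.
  rewrite -big_mkcond (big_pred1 (Ordinal jm)) => [|k] /=; last by rewrite -val_eqE.
  have -> : (2 * (N + j))%:R * th = N%:R * (2 * th) + j%:R * (2 * th).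
    by rewrite natrM natrD; ring.
  by rewrite cosD; ring.
rewrite /half_sum; under eq_bigr do rewrite /rs_coef mulrDl.
have ReD (u v : R[i]) : complex.Re (u + v) = complex.Re u + complex.Re v.
  by case: u; case: v.
rewrite big_split /= (one T); last by lia.
by rewrite (one (2 * T)%N)// /rs_cosine ReD.
Qed.

(** As [2 ^ t <= T], the frequencies [2 (T + j)] and [2 (2 T + i)] never coincide, so at most one
    term is present. *)
Lemma rs_coef_sign (t T k : nat) : (2 ^ t <= T)%N ->
  rs_coef t T k = 0 \/
  ((rs_coef t T k = 1 \/ rs_coef t T k = -1) /\ ~~ odd k /\ (0 < k)%N).
Proof.
move=> tT.
have one (N : nat) (c : nat -> R) : \sum_(j < 2 ^ t | k == (2 * (N + j))%N) c j = 0 \/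
    exists2 j, (j < 2 ^ t)%N & k = (2 * (N + j))%N /\
      \sum_(j < 2 ^ t | k == (2 * (N + j))%N) c j = c j.
  have [j /eqP jk|none] := pickP (fun j : 'I_(2 ^ t) => k == (2 * (N + j))%N); last first.
    by left; rewrite big_pred0// => j; exact: none.
  right; exists j => //; split=> //; rewrite (big_pred1 j)// => i /=.
  by rewrite jk eqn_pmul2l// eqn_add2l eq_sym.
have p0 : (0 < 2 ^ t)%N by rewrite expn_gt0.
have odd2 n : ~~ odd (2 * n) by rewrite oddM.
rewrite /rs_coef; case: (one T (rs t).1) => [->|[j jt [kj ->]]];
  case: (one (2 * T)%N (rs t).2) => [->|[i it [ki ->]]].
- by left; rewrite addr0.
- right; rewrite add0r; have [_ s] := @rs_sign R t i; split=> //.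
  by rewrite ki odd2; split=> //; lia.
- right; rewrite addr0; have [s _] := @rs_sign R t j; split=> //.
  by rewrite kj odd2; split=> //; lia.
- by exfalso; lia.
Qed.

End Assembly.

(** * Reduction to the quarter circle and flatness at one scale *)

Section Scale.
Context {R : realType}.
Implicit Types (x y th : R).

Lemma circle_param (z : R[i]) : normc z = 1 -> exists2 th : R, 0 <= th <= pi / 2 &
  [\/ z = cis th, z = cis (- th), z = cis (pi - th) | z = cis (- (pi - th))].
Proof.
case: z => x y z1.
have xy : x ^+ 2 + y ^+ 2 = 1 by rewrite -[LHS](normc_sqr (x +i* y)) z1 expr1n.
have x1 : 0 <= `|x| <= 1.
  by rewrite normr_ge0 -(@expr_le1 _ 2)// real_normK ?num_real// -xy lerDl sqr_ge0.
have x1' : -1 <= `|x| <= 1 by case/andP: x1 => *; apply/andP; split; lra.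
pose th := acos `|x|.
have c : cos th = `|x| by rewrite /th acosK// in_itv.
have s : sin th = `|y|.
  by rewrite /th sin_acos// real_normK ?num_real// -xy addrC addKr sqrtr_sqr.
have t0 : 0 <= th by exact: acos_ge0.
have tp : th <= pi by exact: acos_lepi.
have p2 := @pihalf_02 R; have p0 := @pi_ge0 R.
exists th.
  rewrite t0 /= leNgt; apply/negP => lt.
  have : cos th < cos (pi / 2) by rewrite ltr_cos// in_itv /=; apply/andP; split; lra.
  by rewrite cos_pihalf c; have /andP[] := x1; lra.
have cB : cos (pi - th) = - cos th by rewrite cosB cospi sinpi; ring.
have sB : sin (pi - th) = sin th by rewrite sinB cospi sinpi; ring.
have [x0|x0] := leP 0 x; have [y0|y0] := leP 0 y.
- by constructor 1; rewrite /cis c s !ger0_norm.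
- by constructor 2; rewrite /cis cosN sinN c s ger0_norm// ltr0_norm// opprK.
- by constructor 3; rewrite /cis cB sB c s ltr0_norm// ger0_norm// opprK.
- by constructor 4; rewrite /cis cosN sinN cB sB c s !ltr0_norm// !opprK.
Qed.

Lemma sin_odd_reflect (k : nat) th : odd k -> sin (k%:R * (pi - th)) = sin (k%:R * th).
Proof.
move=> ok; rewrite -[k]odd_double_half ok /=.
have -> : (1 + k./2.*2)%:R * (pi - th) = pi - (1 + k./2.*2)%:R * th + pi *+ 2 *+ k./2.
  by rewrite -mulrnA -[pi *+ _]mulr_natr natrD -mul2n natrM; ring.
by rewrite (periodicn (@sinD2pi R)) sinB sinpi cospi; ring.
Qed.

Lemma cos_even_reflect (k : nat) th : ~~ odd k -> cos (k%:R * (pi - th)) = cos (k%:R * th).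
Proof.
move=> ek; rewrite -[k]odd_double_half (negbTE ek) /= add0n.
have -> : (k./2.*2)%:R * (pi - th) = - ((k./2.*2)%:R * th) + pi *+ 2 *+ k./2.
  by rewrite -mulrnA -[pi *+ _]mulr_natr -mul2n natrM; ring.
by rewrite (periodicn (@cosD2pi R)) cosN.
Qed.

Lemma rs_cosine_le (t T : nat) x : `|rs_cosine t T x| <= 2 * Num.sqrt (2 ^+ t.+1).
Proof.
apply: le_trans (Re_le_normc _) _; apply: le_trans (normcD _ _) _.
rewrite (normcM _ (rsP t x)) (normcM _ (rsQ t x)) !normc_cis !mul1r.
by have [] := rs_normc_le t x; lra.
Qed.

Lemma cell_of (M H : nat) th : (0 < H)%N -> H%:R * cell_width M = pi / 2 :> R ->
  0 <= th <= pi / 2 ->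
  exists2 d, (d < H)%N & d%:R * cell_width M <= th <= d.+1%:R * cell_width M.
Proof.
move=> H0 HE /andP[t0 t1]; set h := cell_width M in HE *.
have h0 : 0 < h.
  have p2 := @pihalf_02 R; have HR : 0 < H%:R :> R by rewrite ltr0n.
  by rewrite -(pmulr_rgt0 _ HR) HE; case/andP: p2.
have [tlt|tge] := ltP th (pi / 2); last first.
  by exists H.-1; rewrite ?prednK// HE t1 andbT (le_trans _ tge)// -HE ler_wpM2r ?(ltW h0)// ler_nat leq_pred.
exists (Num.truncn (th / h)).
  rewrite -(@ltr_nat R) -(ltr_pM2r h0) HE; apply: le_lt_trans tlt.
  by rewrite -ler_pdivlMr// truncn_le divr_ge0// ltW.
rewrite -ler_pdivlMr// truncn_le divr_ge0 ?(ltW h0)//= -ler_pdivrMr//.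
exact/ltW/truncnS_gt.
Qed.

Section FixedScale.
Variables (rho a t' m : nat).
Let t := t'.*2.+1.
Let b := (2 ^ (rho * 4 + 2))%N.
Let T := (2 ^ a * 2 ^ t)%N.
Let M := (T * b)%N.
Let X : R := (120 * b%:R) ^+ 5.
Let e : R := (8 * X)^-1.
Let mu : R := Num.sqrt M%:R.
Hypotheses (rhoP : 32 * 1000 * (56 * 1000) <= 2 ^+ rho :> R) (b2 : (2048 <= b)%N)
  (aP : 128 * X <= 2 ^+ a) (mM : (2 * M <= m)%N) (mM' : (m.+1 <= 8 * M)%N).

(* The sine part is made at least [14 * 1000 * mu] on the bad cells, because rounding its
   coefficients costs at most [13 * 1000 * mu]; large [rho] keeps the coefficients below 1,
   and large [a] makes the Rudin-Shapiro pair nearly constant on each block of cells. *)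
Lemma flat_at_scale : exists c d : nat -> R,
  [/\ c 0%N = 0,
      forall k, (c k = 0 /\ (d k = 1 \/ d k = -1)) \/ ((c k = 1 \/ c k = -1) /\ d k = 0) &
      forall z : R[i], normc z = 1 -> exists2 th, z = cis th &
        [/\ `|half_sum m c cos th| <= 2 * mu,
            `|half_sum m d sin th| <= 6 * 1000 * 1000 * mu &
            e * Num.sqrt (2 ^+ t.+1) <= `|half_sum m c cos th| \/
            mu <= `|half_sum m d sin th|]].
Proof.
have b0 : (0 < b)%N by rewrite expn_gt0.
have T0 : (0 < T)%N by rewrite muln_gt0 !expn_gt0.
have M0 : (0 < M)%N by rewrite muln_gt0 T0.
have MR : 0 < M%:R :> R by rewrite ltr0n.
have mu0 : 0 < mu by rewrite sqrtr_gt0.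
have mu2 : mu ^+ 2 = M%:R by rewrite sqr_sqrtr// ltW.
have bR : 0 < b%:R :> R by rewrite ltr0n.
have X0 : 0 < X by rewrite exprn_gt0// mulr_gt0.
have a0 : 0 < 2 ^+ a :> R by rewrite exprn_gt0.
have r0 : 0 < 2 ^+ rho :> R by rewrite exprn_gt0.
have e0 : 0 <= e by rewrite invr_ge0 mulr_ge0// ltW.
(* The choice of [e] makes the first part exactly 1/2; [2 ^+ a >= 128 * X] and [pi <= 4] leave at
   most 1/2 for the second. *)
have small : (120 * b%:R) ^+ 5 * (4 * (e + 4 * 2 ^+ t * pi / T%:R)) <= 1.
  rewrite -/X; have -> : 4 * 2 ^+ t * pi / T%:R = 4 * pi / 2 ^+ a :> R.
    rewrite /T natrM !natrX; field; rewrite !gt_eqF ?exprn_gt0//.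
  have -> : X * (4 * (e + 4 * pi / 2 ^+ a)) = 1 / 2 + 16 * X * pi / 2 ^+ a.
    by rewrite /e; field; rewrite !gt_eqF.
  have : 16 * X * pi / 2 ^+ a <= 1 / 2.
    have /andP[_ p2] := @pihalf_02 R.
    have : X * pi <= X * 4 by rewrite ler_wpM2l ?(ltW X0)//; lra.
    by rewrite ler_pdivrMr//; have := aP; lra.
  lra.
pose bad := @bad_cell R t T M e.
have todd : t = t./2.*2.+1 by rewrite /t /= uphalf_double.
have card8 := bad_cells_block T0 b0 (erefl M) e0 small.
have edge : forall c, (c < T * (16 * b))%N -> bad c -> (b <= c)%N /\ (c + b <= T * (16 * b))%N.
  move=> c cH bc; exact: (bad_cells_edge T0 b0 (erefl M) e0 small todd cH bc).
pose A : R := 56 * 1000 * mu.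
pose D : R := mu / 2 ^+ rho.
have A0 : 0 < A by rewrite !mulr_gt0.
have D0 : 0 < D by rewrite divr_gt0.
(* This fixes the exponent in [b]: [D ^+ 4 = M ^ 2 / 2 ^ (4 rho) = 4 M T], and [T + 1 <= 2 T]. *)
have hD : (2 * M)%:R * T.+1%:R <= D ^+ 4.
  have -> : D ^+ 4 = (mu ^+ 2) ^+ 2 / 2 ^+ rho ^+ 4 by rewrite /D; field; rewrite gt_eqF.
  have -> : mu ^+ 2 ^+ 2 / 2 ^+ rho ^+ 4 = (2 * M)%:R * (2 * T)%:R :> R.
    by rewrite mu2 /M /T /b !natrM !natrX exprD exprM; field; rewrite gt_eqF.
  by rewrite ler_wpM2l// ler_nat mul2n -addnn -addn1 leq_add2l.
have hA : 32 * 1000 * A * D <= M%:R.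
  have -> : 32 * 1000 * A * D = (32 * 1000 * (56 * 1000)) * M%:R / 2 ^+ rho.
    by rewrite /A /D -mu2; field; rewrite gt_eqF.
  by rewrite ler_pdivrMr// [leRHS]mulrC ler_wpM2r// ltW.
have [x [x1 xeven xP]] := sine_construction T0 b2 (erefl M) card8 edge A0 D0 hD hA.
pose x' k := if (k < 2 * M)%N then x k else 0.
have x'1 k : `|x' k| <= 1 by rewrite /x'; case: ifP; rewrite ?normr0.
pose c := @rs_coef R t T.
pose free k := c k == 0.
have [eps epsP] := @round_sines R m x' free x'1.
pose d k : R := if free k then (-1) ^+ eps k else 0.
pose sh th := \sum_(k < 2 * M) x k * sin (k%:R * th).
have tT : (2 ^ t <= T)%N by rewrite leq_pmull// expn_gt0.
have csign k := @rs_coef_sign R t T k tT.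
have TM : (2048 * T <= M)%N by rewrite mulnC leq_mul2l b2 orbT.
have Tm : (2 * (2 * T + 2 ^ t) <= m)%N.
  apply: leq_trans mM; rewrite leq_mul2l /=; apply: leq_trans TM.
  apply: (@leq_trans (2 * T + T)); first by rewrite leq_add2l.
  by rewrite -[X in (_ + X)%N]mul1n -mulnDl leq_mul2r orbT.
(* [x'] vanishes at even frequencies, hence wherever [c] is nonzero, so restricting to [free] loses
   nothing. The error is at most [3003 * 4 * mu], as [m + 1 <= 8 M]. *)
have dE th : `|half_sum m d sin th - sh th| <= 13 * 1000 * mu.
  have -> : half_sum m d sin th - sh th =
      \sum_(k < m.+1 | free k) ((-1) ^+ eps k - x' k) * sin (k%:R * th).
    have -> : sh th = \sum_(k < m.+1 | free k) x' k * sin (k%:R * th).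
      rewrite /sh (big_ord_widen m.+1 (fun k => x k * sin (k%:R * th))); last exact: leq_trans mM _.
      rewrite big_mkcond [RHS]big_mkcond; apply: eq_bigr => k _ /=; rewrite /x'.
      case: ifP => k2; last by case: ifP; rewrite ?mul0r.
      case: ifP => // /negbT fk; rewrite xeven ?mul0r//.
      by have [c0|[_ []]] := csign k => //; rewrite /free /c c0 eqxx in fk.
    rewrite /half_sum /d [X in _ - X]big_mkcond [RHS]big_mkcond -sumrB.
    by apply: eq_bigr => k _ /=; case: ifP => _; rewrite ?mulrBl// mul0r subrr.
  apply: le_trans (epsP th) _.
  have : Num.sqrt (2 * m.+1%:R) <= 4 * mu.
    rewrite -[leRHS]ger0_norm ?mulr_ge0 ?(ltW mu0)// -sqrtr_sqr ler_wsqrtr//.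
    rewrite exprMn mu2; have : m.+1%:R <= 8 * M%:R :> R by rewrite -natrM ler_nat.
    lra.
  lra.
pose C th := half_sum m c cos th.
(* Stated for the unrounded [sh], which has both symmetries; rounding may destroy the reflection in
   [pi / 2], so its error is added only in [fin]. *)
pose G th := [/\ `|C th| <= 2 * mu, `|sh th| <= 100 * A &
  e * Num.sqrt (2 ^+ t.+1) <= `|C th| \/ A / 4 <= `|sh th|].
have HE : (T * (16 * b))%:R * cell_width M = pi / 2 :> R.
  have TR : 0 < T%:R :> R by rewrite ltr0n.
  by rewrite /cell_width /M (natrM _ T (16 * b)) (natrM _ 16 b) (natrM _ T b); field; rewrite !gt_eqF.
have CE th : C th = rs_cosine t T (2 * th) by exact: rs_coef_sum.
have sM : Num.sqrt (2 ^+ t.+1) <= mu.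
  rewrite ler_wsqrtr// -natrX ler_nat; apply: leq_trans TM.
  by rewrite expnS leq_mul.
have G0 th : 0 <= th <= pi / 2 -> G th.
  move=> t01; have H0 : (0 < T * (16 * b))%N by rewrite muln_gt0 T0 muln_gt0 b0.
  have [i iH ith] := cell_of H0 HE t01.
  have [s1 s2] := xP i th iH ith; split=> //.
    by rewrite CE; have := rs_cosine_le t T (2 * th); lra.
  have [bi|/asboolPn nb] := boolP (bad i); [by right; exact: s2|left].
  rewrite CE leNgt; apply/negP => lt; apply: nb; exists th => //; exact: ltW.
have GN th : G th -> G (- th).
  have -> : G (- th) = G th; last by [].
  rewrite /G; have -> : C (- th) = C th.
    by apply: eq_bigr => k _; rewrite mulrN cosN.
  have -> : sh (- th) = - sh th.
    by rewrite -sumrN; apply: eq_bigr => k _; rewrite mulrN sinN mulrN.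
  by rewrite normrN.
have GB th : G th -> G (pi - th).
  have -> : G (pi - th) = G th; last by [].
  rewrite /G; have -> : C (pi - th) = C th.
    apply: eq_bigr => k _; have [c0|[_ [ek _]]] := csign k; first by rewrite /c c0 !mul0r.
    by rewrite cos_even_reflect.
  have -> : sh (pi - th) = sh th.
    apply: eq_bigr => k _; have [ok|ek] := boolP (odd k); first by rewrite sin_odd_reflect.
    by rewrite xeven// !mul0r.
  by [].
exists c, d; split.
- by have [//|[_ []]] := csign 0%N.
- move=> k; rewrite /d; have [c0|[c1 _]] := csign k.
    left; split=> //; rewrite /free /c c0 eqxx.
    by case: (eps k); [right|left].
  right; split=> //; rewrite /free /c; case: eqP => // c0; exfalso.
  by case: c1 c0 => -> /eqP; rewrite ?oppr_eq0 oner_eq0.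
move=> z z1; have [th th01 zth] := circle_param z1.
have fin y : z = cis y -> G y -> exists2 th, z = cis th &
    [/\ `|half_sum m c cos th| <= 2 * mu, `|half_sum m d sin th| <= 6 * 1000 * 1000 * mu &
      e * Num.sqrt (2 ^+ t.+1) <= `|half_sum m c cos th| \/ mu <= `|half_sum m d sin th|].
  move=> zy [g1 g2 g3]; exists y => //; have dy := dE y; split=> //.
    have := ler_normD (sh y) (half_sum m d sin y - sh y).
    by rewrite addrC subrK; move: g2; rewrite /A; lra.
  case: g3 => [g3|g3]; [by left|right].
  have := ler_normB (half_sum m d sin y) (half_sum m d sin y - sh y).
  by rewrite opprB addrC subrK; move: g3; rewrite /A; lra.
case: zth => zE; apply: (fin _ zE); [exact: G0|exact/GN/G0|exact/GB/G0|exact/GN/GB/G0].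
Qed.

End FixedScale.

End Scale.

(** * Small degrees, and the choice of scale for large ones *)

Section Final.
Context {R : realType}.
Implicit Types (z : R[i]).

(* With [w = z^(n+1)], the polynomial [P = X^n + ... + X - 1] satisfies [(z - 1) P(z) = w + 1 - 2 z].
   On the circle this is small only if [w] is close to 1, hence only if [z] is. *)
Lemma small_littlewood (n : nat) : (2 <= n)%N ->
  exists P : {poly R[i]}, littlewood n P /\
    forall z, normc z = 1 -> (16 * n%:R ^+ 2)^-1 <= normc P.[z] <= n%:R + 3.
Proof.
move=> n2; have nR : 2 <= n%:R :> R by rewrite ler_nat.
exists (\poly_(i < n.+1) (if i == 0%N then -1 else 1)); split.
  split; first by rewrite size_poly_eq//= ifN ?oner_eq0//; case: (n) n2.
  by move=> k kn; rewrite coef_poly ltnS kn; case: ifP; [right|left].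
move=> z z1; set P := \poly_(i < _) _.
have PE : P.[z] = \sum_(i < n.+1) z ^+ i - 2.
  rewrite /P horner_poly !big_ord_recl /=.
  have -> : \sum_(i < n) (if bump 0 i == 0%N then -1 else 1) * z ^+ bump 0 i =
      \sum_(i < n) z ^+ bump 0 i by apply: eq_bigr => i _; rewrite mul1r.
  by rewrite expr0; ring.
have zi i : normc (z ^+ i) = 1.
  by elim: i => [|i IH]; rewrite ?expr0 ?normc1// exprS normcM z1 IH mulr1.
have normc_nat (k : nat) : normc (k%:R : R[i]) = k%:R.
  by rewrite -(rmorph_nat (real_complex R)) normc_real ger0_norm.
have normcB (u v : R[i]) : normc (u - v) <= normc u + normc v.
  by rewrite -[normc v]normcN; exact: normcD.
apply/andP; split; last first.
  rewrite PE; apply: le_trans (normcB _ _) _; rewrite (normc_nat 2%N).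
  have : normc (\sum_(i < n.+1) z ^+ i) <= n.+1%:R.
    apply: le_trans (normc_sum _ _ _) _.
    by under eq_bigr do rewrite zi; rewrite sumr_const card_ord.
  by rewrite -[n.+1%:R]natr1; lra.
set d := normc (z - 1); set y := normc P.[z].
have d0 : 0 <= d by exact: normc_ge0.
have y0 : 0 <= y by exact: normc_ge0.
have d2 : d <= 2 by apply: le_trans (normcB _ _) _; rewrite z1 normc1; lra.
have n16 : 0 < 16 * n%:R ^+ 2 :> R by rewrite mulr_gt0// exprn_gt0//; lra.
have nearz : n%:R - 1 - (n.+1%:R * n%:R) * d <= y.
  have zid i : normc (z ^+ i - 1) <= i%:R * d.
    rewrite subrX1 normcM mulrC ler_wpM2r//; apply: le_trans (normc_sum _ _ _) _.
    by under eq_bigr do rewrite zi; rewrite sumr_const card_ord.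
  have E : P.[z] = (n%:R - 1) + \sum_(i < n.+1) (z ^+ i - 1).
    rewrite PE sumrB sumr_const card_ord -natr1; ring.
  have h1 : normc (\sum_(i < n.+1) (z ^+ i - 1)) <= n.+1%:R * n%:R * d.
    apply: le_trans (normc_sum _ _ _) _.
    apply: (@le_trans _ _ (\sum_(i < n.+1) n%:R * d)).
      apply: ler_sum => i _; apply: le_trans (zid i) _.
      by rewrite ler_wpM2r// ler_nat -ltnS.
    by rewrite sumr_const card_ord -[leLHS]mulr_natl mulrA.
  have := normcB P.[z] (\sum_(i < n.+1) (z ^+ i - 1)).
  rewrite {1}E addrK -(natrB _ (ltnW n2)) normc_nat natrB ?(ltnW n2)// -/y; lra.
have fary : d ^+ 2 / 4 <= d * y.
  set w := z ^+ n.+1; set eta := normc (w + 1 - 2 * z).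
  have etaE : eta = d * y.
    rewrite /eta /d /y -normcM; congr normc; rewrite PE mulrBr -subrX1 /w; ring.
  have AB : normc (w + 1) ^+ 2 + normc (w - 1) ^+ 2 = 4.
    by rewrite normc_sqrD normc1 zi expr1n; lra.
  set A := normc (w - 1) in AB; set B := normc (w + 1) in AB.
  have A0 : 0 <= A by exact: normc_ge0.
  have B0 : 0 <= B by exact: normc_ge0.
  have eta0 : 0 <= eta by exact: normc_ge0.
  have z2 : normc (2 * z) = 2 by rewrite normcM z1 mulr1 (normc_nat 2%N).
  have B2 : 2 <= B + eta.
    have := normcB (w + 1) (w + 1 - 2 * z).
    by rewrite opprB addrC subrK z2.
  have A2 : 2 * d <= A + eta.
    have := normcB (w - 1) (w + 1 - 2 * z).
    have -> : w - 1 - (w + 1 - 2 * z) = 2 * (z - 1) by ring.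
    by rewrite normcM (normc_nat 2%N).
  (* [B >= 2 - eta] gives [A ^ 2 <= 4 eta], so [eta < d ^ 2 / 4] would force [A < d], against
     [2 d <= A + eta] and [d <= 2]. *)
  rewrite -etaE leNgt; apply/negP => lt.
  have eta1 : eta < 1 by nra.
  have : A ^+ 2 < d ^+ 2 by nra.
  by rewrite ltr_pXn2r ?nnegrE// => Ad; nra.
(* Within [1 / (4 n ^ 2)] of 1 the value [P(1) = n - 1] dominates; farther out [y >= d / 4] is
   enough. *)
have [dle|dgt] := leP (4 * n%:R ^+ 2 * d) 1.
  apply: (@le_trans _ _ (1 / 2)).
    rewrite invf_ple ?posrE//; first nra.
    lra.
  by move: nearz; rewrite -[n.+1%:R]natr1; nra.
have dpos : 0 < d by rewrite lt_def d0 andbT; apply: contraTneq dgt => ->; rewrite mulr0 ltNge ler01.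
have : d / 4 <= y.
  by rewrite -(ler_pM2l dpos); apply: le_trans fary; rewrite expr2; lra.
apply: le_trans; rewrite -[leLHS]mul1r ler_pdivrMr//; nra.
Qed.

(** [t] runs through the odd numbers, so the available scales grow by factors of 4; this is the gap
    between [2 M <= m] and [m < 8 M]. *)
Lemma scale_exists (M0 m : nat) : (0 < M0)%N -> (2 * M0 <= m)%N ->
  exists t', (2 * (M0 * 4 ^ t') <= m)%N /\ (m.+1 <= 8 * (M0 * 4 ^ t'))%N.
Proof.
move=> M00 mM; exists (trunc_log 4 (m %/ (2 * M0))).
have q0 : (0 < m %/ (2 * M0))%N by rewrite divn_gt0// muln_gt0.
have /andP[l1 l2] := trunc_log_bounds (isT : (1 < 4)%N) q0.
set k := trunc_log _ _ in l1 l2 *; have w0 : (0 < 2 * M0)%N by rewrite muln_gt0.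
split; first by rewrite mulnA mulnC -leq_divRL.
by move: l2; rewrite ltn_divLR// expnS; lia.
Qed.

Lemma half_bounds (n K : nat) :
  [/\ (4 * K + 2 <= n -> 2 * K <= n./2)%N, (2 * K <= n./2 -> K <= n)%N &
      (n./2.+1 <= 8 * K -> n <= 16 * K)%N].
Proof. by rewrite -{1 4 6}[n]odd_double_half; case: (odd n) => /=; split; lia. Qed.

Lemma large_littlewood : exists delta Delta : R, exists n0 : nat, 0 < delta /\
  forall n : nat, (n0 <= n)%N -> exists P : {poly R[i]}, littlewood n P /\
    forall z, normc z = 1 ->
      delta * Num.sqrt n%:R <= normc P.[z] <= Delta * Num.sqrt n%:R.
Proof.
have pow2 (x : R) : exists k : nat, x <= 2 ^+ k.
  exists (Num.truncn x).+1; apply: le_trans (ltW (truncnS_gt x)) _.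
  by rewrite -natrX ler_nat ltnW// ltn_expl.
have [rho' rhoP'] := pow2 (32 * 1000 * (56 * 1000)).
(* The [+ 3] ensures that [b] exceeds 2048. *)
pose rho := (rho' + 3)%N.
have rhoP : 32 * 1000 * (56 * 1000) <= 2 ^+ rho :> R.
  by apply: le_trans rhoP' _; rewrite ler_weXn2l ?leq_addr// ler1n.
pose b := (2 ^ (rho * 4 + 2))%N.
have b2 : (2048 <= b)%N.
  rewrite (_ : 2048 = 2 ^ 11)%N//.
  by rewrite leq_exp2l// /rho; lia.
have [a aP] := pow2 (128 * (120 * b%:R) ^+ 5).
pose M0 := (2 ^ a * 2 * b)%N.
have M00 : (0 < M0)%N by rewrite !muln_gt0 !expn_gt0.
pose e : R := (8 * (120 * b%:R) ^+ 5)^-1.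
have bR : 0 < b%:R :> R by rewrite ltr0n expn_gt0.
have e0 : 0 < e by rewrite invr_gt0 mulr_gt0// exprn_gt0// mulr_gt0.
pose q : R := 2 / (2 ^+ a * b%:R).
have q0 : 0 < q by rewrite divr_gt0// mulr_gt0// exprn_gt0.
(* Since [2 ^ (t + 1) = q M], the factor [e * sqrt q] turns the cosine alternative into a multiple
   of [mu]; the sine alternative allows 1. *)
pose kap := Num.min (e * Num.sqrt q) 1.
have kap0 : 0 < kap by rewrite lt_min ltr01 andbT mulr_gt0// sqrtr_gt0.
have kap1 : kap <= 1 by rewrite ge_min lexx orbT.
have kape : kap <= e * Num.sqrt q by rewrite ge_min lexx.
(* For [n >= n1] one has [kap * sqrt n >= 8], hence [kap * mu >= 2]. This absorbs the stray terms of
   modulus at most 1: [d 0] and, for odd [n], the added [z ^+ n]. *)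
pose n1 := (Num.truncn (64 / kap ^+ 2)).+1.
exists (kap / 4), (13 * 1000 * 1000), (n1 + (4 * M0 + 2))%N; split; first by rewrite divr_gt0.
move=> n nn0; pose m := n./2.
have nE : n = (odd n + (m + m))%N by rewrite addnn odd_double_half.
have [t' [mM mM']] : exists t', (2 * (M0 * 4 ^ t') <= m)%N /\ (m.+1 <= 8 * (M0 * 4 ^ t'))%N.
  apply: scale_exists => //; have [h _ _] := half_bounds n M0; apply: h.
  exact: leq_trans (leq_addl _ _) nn0.
pose T := (2 ^ a * 2 ^ t'.*2.+1)%N; pose M := (T * b)%N.
have ME : (M0 * 4 ^ t')%N = M.
  rewrite /M /T /M0 expnS -mul2n expnM; ring.
rewrite ME in mM mM'.
have [c [d [c0 cd flat]]] := flat_at_scale rhoP b2 aP mM mM'.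
set mu : R := Num.sqrt _ in flat.
have muM : mu ^+ 2 = M%:R by rewrite sqr_sqrtr.
have mu0 : 0 <= mu by exact: sqrtr_ge0.
pose sn : R := Num.sqrt n%:R.
have sn0 : 0 <= sn by exact: sqrtr_ge0.
have sn2 : sn ^+ 2 = n%:R by rewrite sqr_sqrtr.
have mule : mu <= sn.
  by rewrite ler_wsqrtr// ler_nat; have [_ h _] := half_bounds n M; apply: h.
have snle : sn <= 4 * mu.
  rewrite -(@ler_pXn2r _ 2) ?nnegrE ?mulr_ge0// exprMn sn2 muM.
  have : (n <= 16 * M)%N by have [_ _ h] := half_bounds n M; apply: h.
  by rewrite -(ler_nat R) natrM; lra.
have kmu : 2 <= kap * mu.
  have : 8 <= kap * sn.
    rewrite -(@ler_pXn2r _ 2) ?nnegrE ?mulr_ge0 ?(ltW kap0)// exprMn sn2.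
    rewrite mulrC -ler_pdivrMr ?exprn_gt0//.
    apply: (@le_trans _ _ n1%:R).
      by apply: le_trans (ltW (truncnS_gt _)); rewrite ler_pM2r ?invr_gt0 ?exprn_gt0//; lra.
    by rewrite ler_nat; apply: leq_trans nn0; rewrite leq_addr.
  have : kap * sn <= kap * (4 * mu) by rewrite ler_wpM2l// ltW.
  lra.
have emu : kap * mu <= e * Num.sqrt (2 ^+ (t'.*2.+1).+1).
  have -> : 2 ^+ (t'.*2.+1).+1 = q * M%:R :> R.
    rewrite /M (natrM _ T b) /T natrM (natrX _ 2 a) (natrX _ 2 t'.*2.+1) /q [LHS]exprS.
    by field; rewrite !gt_eqF// exprn_gt0.
  by rewrite sqrtrM ?(ltW q0)// mulrA ler_wpM2r.
have d01 : `|d 0%N| <= 1.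
  by case: (cd 0%N) => [[_ [->|->]]|[_ ->]]; rewrite ?normrN ?normr1 ?normr0 ?ler01.
pose P0 := symm_poly m c d.
have P0b z : normc z = 1 ->
    2 * (kap * mu) - 1 <= normc P0.[z] <= 1 + 4 * mu + 12 * 1000 * 1000 * mu.
  move=> z1; have [th -> [C1 S1 CS]] := flat z z1.
  rewrite /P0 symm_poly_eval// normcM normc_cis mul1r.
  set C := half_sum m c cos th in C1 CS *; set S := half_sum m d sin th in S1 CS *.
  set v : R[i] := _ +i* _.
  have vRe : `|d 0%N + 2 * C| <= normc v by exact: (Re_le_normc v).
  have vIm : `|2 * S| <= normc v by exact: (Im_le_normc v).
  have vle : normc v <= `|d 0%N + 2 * C| + `|2 * S| by exact: (normc_le_ReIm v).
  rewrite normrM [`|2|]ger0_norm// in vIm vle.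
  have h1 := ler_normD (d 0%N) (2 * C); rewrite [`|2 * C|]normrM [`|2|]ger0_norm// in h1.
  have h2 := ler_normB (d 0%N + 2 * C) (d 0%N).
  rewrite addrC addKr [`|2 * C|]normrM [`|2|]ger0_norm// in h2.
  apply/andP; split; last by lra.
  have kmu1 : kap * mu <= mu by rewrite ler_piMl.
  case: CS => CS; last by lra.
  have := le_trans emu CS; lra.
have lw0 : littlewood (m + m) P0 by exact: symm_poly_littlewood.
have mule' : kap * mu <= mu by rewrite ler_piMl.
have final (x : R) : 2 * (kap * mu) - 2 <= x -> x <= 2 + 4 * mu + 12 * 1000 * 1000 * mu ->
    kap / 4 * sn <= x <= 13 * 1000 * 1000 * sn.
  move=> x1 x2; apply/andP; split.
    have : kap * sn <= kap * (4 * mu) by rewrite ler_wpM2l// ltW.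
    lra.
  lra.
move: nE; case: (odd n) => /= nE.
  exists (P0 + 'X^n); split.
    have [sz co] := lw0.
    have szn : size (P0 + 'X^n) = n.+1.
      by rewrite addrC size_polyDl size_polyXn// sz nE.
    split=> // k; rewrite coefD coefXn leq_eqVlt => /predU1P[->|kn].
      by rewrite eqxx nth_default ?sz ?nE// add0r; left.
    by rewrite (ltn_eqF kn) addr0; apply: co; rewrite -ltnS -[(m + m).+1]add1n -nE.
  move=> z z1; have /andP[l u] := P0b z z1.
  have zn : normc (z ^+ n) = 1.
    by elim: (n) => [|i IH]; rewrite ?expr0 ?normc1// exprS normcM z1 IH mulr1.
  rewrite !hornerE; apply: final.
    have := normcD (P0.[z] + z ^+ n) (- z ^+ n); rewrite addrK normcN zn; lra.
  have := normcD P0.[z] (z ^+ n); rewrite zn; lra.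
have E : (m + m)%N = n by rewrite [RHS]nE.
rewrite E in lw0; exists P0; split=> // z z1; have /andP[l u] := P0b z z1.
by apply: final; lra.
Qed.

End Final.

Theorem theorem1p1 (R : realType) :
  exists delta Delta : R, 0 < delta /\ delta < Delta /\
    forall n : nat, (2 <= n)%N ->
      exists P : {poly R[i]}, littlewood n P /\
        forall z : R[i], `|z| = 1 ->
          (delta * Num.sqrt (n%:R))%:C <= `|P.[z]| /\
          `|P.[z]| <= (Delta * Num.sqrt (n%:R))%:C.
Proof.
have [de [De [n0 [de0 large]]]] := @large_littlewood R.
pose N : R := n0%:R + 2.
have N2 : 2 <= N by rewrite /N lerDr.
(* Below degree [n0] both [n] and [sqrt n] are at most [N], so [small_littlewood] allows
   [(16 * N ^+ 3)^-1]. The entry [delta + 1] makes [delta < Delta]. *)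
pose delta := Num.min de (16 * N ^+ 3)^-1.
pose Delta := Num.max (Num.max De (3 * N)) (delta + 1).
have N3 : 0 < 16 * N ^+ 3 by rewrite mulr_gt0// exprn_gt0//; lra.
exists delta, Delta; split; first by rewrite lt_min de0 invr_gt0.
split; first by rewrite lt_max ltrDl ltr01 orbT.
have le1 : delta <= de by rewrite ge_min lexx.
have le2 : delta <= (16 * N ^+ 3)^-1 by rewrite ge_min lexx orbT.
have le3 : De <= Delta by rewrite !le_max lexx.
have le4 : 3 * N <= Delta by rewrite !le_max lexx orbT.
move=> n n2; set s := Num.sqrt _.
have s0 : 0 <= s by exact: sqrtr_ge0.
suff [P [lP bP]] : exists P : {poly R[i]}, littlewood n P /\
    forall z, normc z = 1 -> delta * s <= normc P.[z] <= Delta * s.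
  exists P; split=> // z z1.
  have /bP/andP[b1 b2] : normc z = 1.
    by apply: complexI; rewrite -normc_normE z1.
  by rewrite normc_normE !lecR.
have [nn|nn] := leqP n0 n.
  have [P [lP bP]] := large n nn; exists P; split=> // z z1.
  have /andP[b1 b2] := bP z z1; apply/andP; split.
    by apply: le_trans b1; rewrite ler_wpM2r.
  by apply: le_trans b2 _; rewrite ler_wpM2r.
have [P [lP bP]] := @small_littlewood R n n2; exists P; split=> // z z1.
have /andP[b1 b2] := bP z z1.
have nR : 2 <= n%:R :> R by rewrite ler_nat.
have nn0 : n%:R <= n0%:R :> R by rewrite ler_nat ltnW.
have nN : n%:R <= N by rewrite /N; lra.
have s2 : s ^+ 2 = n%:R by rewrite sqr_sqrtr.
have s1 : 1 <= s by rewrite -(@expr_ge1 _ 2)// s2; lra.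
have sN : s <= N by nra.
apply/andP; split.
  apply: le_trans b1; apply: (@le_trans _ _ ((16 * N ^+ 3)^-1 * N)).
    by rewrite ler_pM// ?le_min ?(ltW de0) ?invr_ge0 ?(ltW N3).
  have -> : (16 * N ^+ 3)^-1 * N = (16 * N ^+ 2)^-1.
    by field; lra.
  rewrite lef_pV2 ?posrE ?mulr_gt0 ?exprn_gt0//; try lra.
  by rewrite ler_wpM2l// lerXn2r ?nnegrE//; lra.
apply: le_trans b2 _; apply: (@le_trans _ _ (3 * N * 1)); first by lra.
by apply: ler_pM => //; lra.
Qed.
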